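(* Let $n\ge1$ and let $(x_1,0),(x,u)\in\mathbb{R}^n\times\mathbb{R}$ with $x_1\ne\pm x$ and $u>0$. Put $a=\frac{2x_1\cdot x}{|x_1|^2+|x|^2}$ and $\mu(b)=\frac{b}{\sin^2b}-\cot b+a\frac{1-b\cot b}{\sin b}$. Then there are finitely many geodesics joining $(x_1,0)$ and $(x,u)$. They are the curves $\gamma^{b}:=\gamma^{b,c}$ with $c=\frac{b}{\sin b}(x-x_1\cos b)$, where $b\in\mathbb{R}\setminus\pi\mathbb{Z}$ is a solution of $$\frac{2u}{|x_1|^2+|x|^2}=\mu(b),$$ and their lengths are strictly increasing with $b$. Moreover, this equation has a unique solution $b$ in the interval $(0,\pi)$, the shortest geodesic joining $(x_1,0)$ and $(x,u)$ is the one given by this solution, and with this $b$ $$d_{CC}\left((x_1,0),(x,u)\right)=L(\gamma^b)=\frac{b}{\sin b}\sqrt{|x_1|^2+|x|^2-2x_1\cdot x\cos b}=\sqrt{2bu+(|x_1|^2+|x|^2)\,b\cot b-2\frac{b}{\sin b}x_1\cdot x}.$$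
   Context: On $\mathbb{R}^{n+1}=\mathbb{R}^n_x\times\mathbb{R}_u$ consider the vector fields $X_j=\partial_{x_j}$, $U_j=x_j\partial_u$ ($j=1,\dots,n$). For $p\in\mathbb{R}^{n+1}$ and a tangent vector $v$ at $p$ put $\|v\|_p^2=\inf\{\sum_{j=1}^n(\alpha_j^2+\beta_j^2): v=\sum_{j=1}^n(\alpha_jX_j(p)+\beta_jU_j(p))\}$, with $\inf\varnothing=\infty$. A horizontal curve is an absolutely continuous curve $\gamma:[0,1]\to\mathbb{R}^{n+1}$ with $\dot\gamma(t)\in\mathrm{span}\{X_j(\gamma(t)),U_j(\gamma(t)):1\le j\le n\}$ for almost every $t$; its length is $L(\gamma)=\int_0^1\|\dot\gamma(t)\|_{\gamma(t)}\,dt$. The Carnot–Carathéodory distance $d_{CC}(p,q)$ is the infimum of $L(\gamma)$ over all horizontal curves $\gamma$ with $\gamma(0)=p$, $\gamma(1)=q$. Geodesics (solutions of the Euler–Lagrange equations of the energy $\int_0^1\|\dot\gamma\|_\gamma^2dt$): the geodesics starting at $(x_1,0)$ are exactly the curves $\gamma^{b,c}=(\gamma^{b,c}_{(1)},\gamma^{b,c}_{(2)}):[0,1]\to\mathbb{R}^n\times\mathbb{R}$ with parameters $b\in\mathbb{R}$, $c\in\mathbb{R}^n$, where for $b\neq0$ $$\gamma^{b,c}_{(1)}(t)=\frac cb\sin(bt)+x_1\cos(bt),$$ $$\gamma^{b,c}_{(2)}(t)=\frac{|c|^2}{b}\left(\frac t2-\frac{\sin(2bt)}{4b}\right)+\frac{x_1\cdot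 c}{b}\sin^2(bt)+|x_1|^2b\left(\frac t2+\frac{\sin(2bt)}{4b}\right),$$ and $\gamma^{0,c}(t)=(ct+x_1,0)$. Their length is $L(\gamma^{b,c})=\sqrt{|c|^2+|x_1|^2b^2}$. A geodesic joins $(x_1,0)$ and $(x,u)$ if $\gamma^{b,c}(1)=(x,u)$. *)

(* Defs.v *)
From HB Require Import structures.
From mathcomp Require Import all_boot all_order all_algebra.
From mathcomp Require Import all_classical all_reals all_analysis.
From mathcomp Require Import ring lra.

Set Implicit Arguments.
Unset Strict Implicit.
Unset Printing Implicit Defensive.

Import Order.TTheory GRing.Theory Num.Theory.
Import numFieldNormedType.Exports.

Local Open Scope classical_set_scope.
Local Open Scope ring_scope.

Section Definitions.
Context {R : realType}.

Definition dot (n : nat) (x y : 'rV[R]_n) : R := \sum_(j < n) x 0 j * y 0 j.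
Definition sqnorm (n : nat) (x : 'rV[R]_n) : R := dot x x.

Section Curves.
Context {n : nat}.
Local Notation space := ('rV[R]_n * R)%type.

Definition Xfield (j : 'I_n) (p : space) : space := (delta_mx 0 j, 0).
Definition Ufield (j : 'I_n) (p : space) : space := (0, p.1 0 j).

Definition hcomb (p : space) (alpha beta : 'rV[R]_n) : space :=
  \sum_(j < n) (alpha 0 j *: Xfield j p + beta 0 j *: Ufield j p).

Definition sqCCnorm (p v : space) : \bar R :=
  ereal_inf [set (sqnorm ab.1 + sqnorm ab.2)%:E
            | ab in [set ab : 'rV[R]_n * 'rV[R]_n | v = hcomb p ab.1 ab.2]].
Definition CCnorm (p v : space) : \bar R := sqrte (sqCCnorm p v).

(* Curves on [0, 1] are total functions on R of which only the values on [0, 1]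
   matter. *)
Definition abs_continuous01 (g : R -> space) : Prop :=
  forall e : R, 0 < e -> exists2 d : R, 0 < d &
    forall (m : nat) (s t : 'I_m -> R),
      (forall i, [/\ 0 <= s i, s i <= t i & t i <= 1]) ->
      trivIset setT (fun i => `]s i, t i[%classic) ->
      \sum_(i < m) (t i - s i) < d ->
      \sum_(i < m) `|g (t i) - g (s i)| < e.

Definition horizontal (g : R -> space) : Prop :=
  abs_continuous01 g /\
  {ae lebesgue_measure, forall t : R, t \in `[0 : R, 1 : R] ->
    derivable g t 1 /\ exists alpha beta, derive1 g t = hcomb (g t) alpha beta}.

Definition CClength (g : R -> space) : \bar R :=
  \int[lebesgue_measure]_(t in `[0 : R, 1 : R]) CCnorm (g t) (derive1 g t).

Definition dCC (p q : space) : \bar R :=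
  ereal_inf [set CClength g | g in
    [set g : R -> space | [/\ horizontal g, g 0 = p & g 1 = q]]].

(* Solutions of the Euler-Lagrange equations of the energy. The energy density
   is |x'|^2 + u'^2 / |x|^2, which is singular on {x = 0}, so the equations are
   written for the controls (alpha, beta): stationarity of
     \int |alpha|^2 + |beta|^2 + 2 lambda (u' - beta . x),  where alpha = x',
   with respect to beta, x and u gives beta = lambda x, alpha' = - lambda beta
   and lambda' = 0. The derivatives are taken on ]0, 1[, since the values of g
   outside [0, 1] are irrelevant. Lemma geodesicP below integrates the
   equations. *)
Definition geodesic (g : R -> space) : Prop :=
  {within `[0 : R, 1 : R], continuous g} /\
  exists (lambda : R) (alpha beta : R -> 'rV[R]_n), forall t : R,
    t \in `]0 : R, 1 : R[ ->
    [/\ is_derive t 1 g (hcomb (g t) (alpha t) (beta t)),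
        beta t = lambda *: (g t).1
      & is_derive t 1 alpha (- lambda *: beta t)].

(* Curves that agree on [0, 1] are identified by restricting them to [0, 1]. *)
Definition geodesics_joining (p q : space) : set (R -> space) :=
  [set g \_ `[0 : R, 1 : R] | g in [set g | [/\ geodesic g, g 0 = p & g 1 = q]]].

Definition gcurve (x1 : 'rV[R]_n) (b : R) (c : 'rV[R]_n) (t : R) : space :=
  if b == 0 then (t *: c + x1, 0) else
  ((sin (b * t) / b) *: c + cos (b * t) *: x1,
   sqnorm c / b * (t / 2 - sin (2 * b * t) / (4 * b))
   + dot x1 c / b * sin (b * t) ^+ 2
   + sqnorm x1 * b * (t / 2 + sin (2 * b * t) / (4 * b))).

End Curves.

Definition cot (b : R) : R := cos b / sin b.

Definition mu (a b : R) : R :=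
  b / sin b ^+ 2 - cot b + a * ((1 - b * cot b) / sin b).

End Definitions.

Section GeodesicEquations.
Context {R : realType} {n : nat}.
Local Notation space := ('rV[R]_n * R)%type.

Lemma sum_pairE (F : 'I_n -> space) :
  \sum_i F i = (\sum_i (F i).1, \sum_i (F i).2).
Proof.
by rewrite [LHS]surjective_pairing; congr pair; apply: big_morph.
Qed.

Lemma hcombE (p : space) a b : hcomb p a b = (a, dot b p.1).
Proof.
rewrite /hcomb sum_pairE /=; congr pair.
- rewrite [RHS]row_sum_delta; apply: eq_bigr => j _.
  by rewrite scaler0 addr0.
- by apply: eq_bigr => j _; rewrite scaler0 add0r.
Qed.

Lemma is_derive_lin (V W : normedModType R) (h : V -> W) (f : R -> V) (t : R) v :
  (forall x y, h (x - y) = h x - h y) -> (forall (k : R) x, h (k *: x) = k *: h x) ->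
  continuous h -> is_derive t 1 f v -> is_derive t 1 (h \o f) (h v).
Proof.
move=> hB hZ ch [df <-].
have H : (fun k : R => k^-1 *: ((h \o f \o shift t) (k *: 1) - (h \o f) t)) @ 0^' --> h ('D_1 f t).
  rewrite (_ : (fun k => _) = h \o (fun k : R => k^-1 *: ((f \o shift t) (k *: 1) - f t))).
    by apply: continuous_cvg; [exact: ch | exact: df].
  by apply/funext => k; rewrite /comp /= hZ hB.

by apply: DeriveDef; [apply/cvg_ex; eexists; exact: H | exact: (cvg_lim _ H)].
Qed.

Lemma is_derive_coord (g : R -> space) (t : R) a b : is_derive t 1 g (a, b) <->
  (forall j, is_derive t 1 (fun s => (g s).1 0 j) (a 0 j)) /\
  is_derive t 1 (fun s => (g s).2) b.
Proof.
split.
- move=> H; split.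
  + have H1 : is_derive t 1 (fst \o g) a.
      apply: (@is_derive_lin _ _ (@fst 'rV[R]_n R)  g t (a,b) _ _ _ H) => //.
      by move=> x; exact: cvg_fst.
    move=> j; move: H1 => [D1 E1]; apply: DeriveDef.
      exact: (derivable_mxP _ _ _).1 D1 0 j.
    by rewrite -E1 derive_mx // mxE.
  + apply: (@is_derive_lin _ _ (@snd 'rV[R]_n R)  g t (a,b) _ _ _ H) => //.
    by move=> x; exact: cvg_snd.
- move=> [H1 H2].
  have H3 : is_derive t 1 (fun s => (g s).1) a.
    have D : derivable (fun s => (g s).1) t 1.
      by apply/derivable_mxP => i j; rewrite ord1; case: (H1 j).
    apply: DeriveDef => //; rewrite derive_mx //; apply/rowP => j; rewrite mxE.
    by case: (H1 j).
  case: H2 => D2 E2; case: H3 => D3 E3.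
  have -> : g = (fun s => ((g s).1, (g s).2)).
    by apply/funext => s; case: (g s).
  move/derivable1_diffP in D2; move/derivable1_diffP in D3.
  apply: DeriveDef; first by apply/derivable1_diffP; exact: differentiable_pair.
  rewrite deriveE; last exact: differentiable_pair.
  by rewrite diff_pair //= -E3 -E2 !deriveE.
Qed.

(* is_derive is a class; isd keeps it out of instance resolution. *)
Definition isd (f : R -> R) (t d : R) : Prop := is_derive t 1 f d.

Lemma is_cst (f : R -> R) (a b : R) : a <= b -> {within `[a, b], continuous f} ->
  (forall t : R, t \in `]a, b[ -> is_derive t 1 f 0) -> f b = f a.
Proof.
move=> ab cf df; have M := @MVT_segment R f (fun=> 0) a b ab df cf.
by case: M => c _ E; apply/eqP; rewrite -subr_eq0 E mul0r.
Qed.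

Lemma cst01 (f : R -> R) : {within `[0 : R, 1 : R], continuous f} ->
  (forall t : R, t \in `]0 : R, 1 : R[ -> isd f t 0) ->
  forall t : R, t \in `[0 : R, 1 : R] -> f t = f 0.
Proof.
move=> cf df t t01; have t0 : 0 <= t by rewrite (itvP t01).
have C : {within `[0, t], continuous f}.
  apply: continuous_subspaceW cf => x /=; rewrite !in_itv /= => /andP[-> xt].
  by rewrite (le_trans xt) // (itvP t01).
have D (x : R) : x \in `]0, t[ -> is_derive x 1 f 0.
  move=> x0t; apply: df; rewrite in_itv /= (itvP x0t) /=.
  by apply: lt_le_trans (_ : x < t) _; rewrite ?(itvP x0t) ?(itvP t01).
exact (is_cst t0 C D).
Qed.

Lemma within_contB (f g : R -> R) :
  {within `[0 : R, 1 : R], continuous f} -> (forall t : R, derivable g t 1) ->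
  {within `[0 : R, 1 : R], continuous (fun s => f s - g s)}.
Proof.
move=> cf dg.
have cg : {within `[0 : R, 1 : R], continuous g}.
  by apply: derivable_within_continuous => t _; exact: dg.
move=> x; exact (continuousB (cf x) (cg x)).
Qed.

Lemma cstoo (f : R -> R) :
  (forall t : R, t \in `]0 : R, 1 : R[ -> isd f t 0) ->
  exists k, forall t : R, t \in `]0 : R, 1 : R[ -> f t = k.
Proof.
move=> df; exists (f (1/2)).
have H (s t : R) : s \in `]0 : R, 1 : R[ -> t \in `]0 : R, 1 : R[ -> s <= t -> f t = f s.
  move=> s01 t01 st; 
  have C : {within `[s, t], continuous f}.
    apply: derivable_within_continuous => x xst.
    suff /df[] : x \in `]0 : R, 1 : R[ by [].
    rewrite in_itv /=; apply/andP; split.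
      by apply: lt_le_trans (_ : s <= x); rewrite ?(itvP s01) ?(itvP xst).
    by apply: le_lt_trans (_ : x <= t) _; rewrite ?(itvP t01) ?(itvP xst).
  have D (x : R) : x \in `]s, t[ -> is_derive x 1 f 0.
    move=> xst; apply: df; rewrite in_itv /=; apply/andP; split.
      by apply: lt_trans (_ : s < x); rewrite ?(itvP s01) ?(itvP xst).
    by apply: lt_trans (_ : x < t) _; rewrite ?(itvP t01) ?(itvP xst).
  exact (is_cst st C D).
have h01 : (1 / 2 : R) \in `]0 : R, 1 : R[ by rewrite in_itv /=; apply/andP; split; lra.
move=> t t01; case: (leP t (1/2)) => [|/ltW] le; last exact: H.
by rewrite (H t (1/2)).
Qed.

Definition galpha (x1 : 'rV[R]_n) b (c : 'rV[R]_n) (t : R) : 'rV[R]_n :=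
  cos (b * t) *: c - (b * sin (b * t)) *: x1.

Lemma is_derive_lincos (b t : R) : is_derive t 1 (fun s => cos (b * s)) (- (b * sin (b * t))).
Proof.
have H : is_derive t 1 (fun s => b * s) b.
  by apply: (is_derive_eq (is_deriveZ b (is_derive_id t 1))); rewrite /= /GRing.scale /= mulr1.
apply: (is_derive_eq (is_derive1_comp (is_derive_cos _) H)).
by rewrite /=; ring.
Qed.
Lemma is_derive_linsin (b t : R) : is_derive t 1 (fun s => sin (b * s)) (b * cos (b * t)).
Proof.
have H : is_derive t 1 (fun s => b * s) b.
  by apply: (is_derive_eq (is_deriveZ b (is_derive_id t 1))); rewrite /= /GRing.scale /= mulr1.
apply: (is_derive_eq (is_derive1_comp (is_derive_sin _) H)).
by rewrite /=; ring.
Qed.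
#[local] Existing Instance is_derive_lincos.
#[local] Existing Instance is_derive_linsin.

Lemma is_derive_gcurve x1 b c (t : R) :
  is_derive t 1 (gcurve x1 b c)
    (hcomb (gcurve x1 b c t) (galpha x1 b c t) (b *: (gcurve x1 b c t).1)) /\
  is_derive t 1 (galpha x1 b c) (- b *: (b *: (gcurve x1 b c t).1)).
Proof.
rewrite hcombE; split.
- apply/is_derive_coord; rewrite /gcurve; case: eqP => [->|/eqP b0]; split => /=.
  + move=> j; rewrite /galpha mul0r cos0 sin0 !mxE.
    rewrite (_ : (fun s => _) = (fun s => s * c 0 j + x1 0 j)); last first.
      by apply/funext => s; rewrite !mxE.
    apply: is_derive_eq; rewrite /= /GRing.scale /=; ring.
  + apply: is_derive_eq; rewrite /dot big1 // => j _; by rewrite scale0r mxE mul0r.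
  + move=> j; rewrite /galpha !mxE.
    rewrite (_ : (fun s => _) = (fun s => (b^-1 * c 0 j) * sin (b * s)  + x1 0 j * cos (b * s))); last first.
      by apply/funext => s; rewrite !mxE; ring.
    apply: is_derive_eq; rewrite /= /GRing.scale /=; by field.
  + set S := sqnorm c; set P := dot x1 c; set Q := sqnorm x1.
    have Es s : sin (2 * b * s) = 2 * (sin (b * s) * cos (b * s)).
      by rewrite -mulrA mulr_natl sin_mulr2n; ring.
    rewrite (_ : (fun s => _) = (fun s => (S / b / 2 + Q * b / 2) * s + (Q / 2 - S / b ^+ 2 / 2) * (sin (b * s) * cos (b * s)) + P / b * (sin (b * s) * sin (b * s)))); last first.
      by apply/funext => s; rewrite Es; field.
    apply: is_derive_eq; rewrite /= /GRing.scale /=.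
    have -> : dot (b *: ((sin (b * t) / b) *: c + cos (b * t) *: x1))
                  ((sin (b * t) / b) *: c + cos (b * t) *: x1) =
        b * ((sin (b * t) / b) ^+ 2 * S + 2 * (sin (b * t) / b) * cos (b * t) * P + cos (b * t) ^+ 2 * Q).
      rewrite /S /P /Q /sqnorm /dot !mulr_sumr -!big_split /= !mulr_sumr; apply: eq_bigr => j _.
      rewrite !mxE; ring.
    have := cos2Dsin2 (b * t); move: (cos (b * t)) (sin (b * t)) => C s E.
    have -> : S / b / 2 + Q * b / 2 = (S / b / 2 + Q * b / 2) * (C ^+ 2 + s ^+ 2) by rewrite E mulr1.
    by field.
- have Dj j : is_derive t 1 (fun s => galpha x1 b c s 0 j) ((- b *: (b *: (gcurve x1 b c t).1)) 0 j).
    rewrite /galpha.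
    rewrite (_ : (fun s => _) = (fun s => c 0 j * cos (b * s) - (b * x1 0 j) * sin (b * s))); last first.
      by apply/funext => s; rewrite !mxE; ring.
    apply: is_derive_eq; rewrite /= /GRing.scale /= /gcurve.
    case: eqP => [->|/eqP b0]; rewrite /= !mxE; first by ring.
    by field.
  have D : derivable (galpha x1 b c) t 1.
    by apply/derivable_mxP => i j; rewrite ord1; case: (Dj j).
  apply: DeriveDef => //; rewrite derive_mx //; apply/rowP => j; rewrite mxE.
  by case: (Dj j).
Qed.

Lemma gcurve0 (x1 : 'rV[R]_n) b c : gcurve x1 b c 0 = (x1, 0).
Proof.
rewrite /gcurve; case: eqP => _; first by rewrite scale0r add0r.
rewrite !mulr0 sin0 cos0 !mul0r scale0r scale1r add0r.
by congr pair; ring.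
Qed.

Lemma geodesicP (x1 : 'rV[R]_n) (g : R -> space) :
  geodesic g /\ g 0 = (x1, 0) <->
  exists b c, forall t : R, t \in `[0 : R, 1 : R] -> g t = gcurve x1 b c t.
Proof.
split=> [[[cg [b [al [be H]]]] g0]|[b [c Eg]]]; last first.
  split; last by rewrite Eg ?gcurve0 // in_itv /= lexx ler01.
  split.
    have C : {within `[0 : R, 1 : R], continuous (gcurve x1 b c)}.
      apply: derivable_within_continuous => t _.
      by case: (is_derive_gcurve x1 b c t) => -[].
    apply: subspace_eq_continuous C => t /set_mem t01.
    exact: esym (Eg _ t01).
  exists b, (galpha x1 b c), (fun t => b *: (gcurve x1 b c t).1) => t t01.
  have t01' : t \in `[0 : R, 1 : R] by apply: subset_itv_oo_cc t01.
  have [D1 D2] := is_derive_gcurve x1 b c t.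
  split; rewrite ?Eg //.
  apply: near_eq_is_derive D1.
  near=> s; rewrite Eg //.
  apply: subset_itv_oo_cc; near: s; exact: near_in_itvoo.
pose y j s := (g s).1 0 j.
have Dy j (t : R) : t \in `]0 : R, 1 : R[ -> is_derive t 1 (y j) (al t 0 j).
  by move=> /H[]; rewrite hcombE => /is_derive_coord[+ _ _ _]; exact.
have Da j (t : R) : t \in `]0 : R, 1 : R[ -> is_derive t 1 (fun s => al s 0 j) (- b ^+ 2 * y j t).
  move=> /H[_ -> [D E]]; apply: DeriveDef; first exact: (derivable_mxP _ _ _).1 D 0 j.
  have := congr1 (fun M : 'rV_n => M 0 j) E; rewrite /= derive_mx // mxE => ->.
  by rewrite !mxE /y; ring.
have Dw (t : R) : t \in `]0 : R, 1 : R[ -> is_derive t 1 (fun s => (g s).2) (b * sqnorm (g t).1).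
  move=> /H[]; rewrite hcombE => /is_derive_coord[_ D] E _.
  apply: (is_derive_eq D); rewrite E /sqnorm /dot mulr_sumr; apply: eq_bigr => j _.
  by rewrite !mxE mulrA.
have cc (h : space -> R) : continuous h -> {within `[0 : R, 1 : R], continuous (h \o g)}.
  by move=> ch t; exact (continuous_comp (cg t) (ch (g t))).
have cy j : {within `[0 : R, 1 : R], continuous (y j)}.
  apply: (cc (fun p => p.1 0 j)) => p.
  by apply: (@continuous_comp _ _ _ fst (fun M : 'rV[R]_n => M 0 j)); [exact: cvg_fst | exact: coord_continuous].
have cw : {within `[0 : R, 1 : R], continuous (fun s => (g s).2)}.
  by apply: (cc snd) => p; exact: cvg_snd.
have h01 : (1 / 2 : R) \in `]0 : R, 1 : R[ by rewrite in_itv /=; apply/andP; split; lra.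
have h01' : (1 / 2 : R) \in `[0 : R, 1 : R] by apply: subset_itv_oo_cc h01.
have [c Hc] : exists c : 'rV[R]_n, forall t : R, t \in `[0 : R, 1 : R] -> (g t).1 = (gcurve x1 b c t).1.
  have K j : exists cj : R, forall t : R, t \in `[0 : R, 1 : R] -> y j t =
      if b == 0 then cj * t + x1 0 j else cj / b * sin (b * t) + x1 0 j * cos (b * t).
    have y0 : y j 0 = x1 0 j by rewrite /y g0.
    have := Dy j; have := Da j; have := cy j; move: (y j) y0 => z z0 cz Dal Dz.
    case: eqP => [b0|/eqP b0].
      have [k Hk] : exists k, forall t : R, t \in `]0 : R, 1 : R[ -> al t 0 j = k.
        apply: cstoo => t /Dal; rewrite /isd b0 expr0n oppr0 mul0r; exact.
      exists k => t t01.
      suff : z t - k * t = z 0 - k * 0 by rewrite z0 mulr0 subr0 => <-; ring.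
      apply: (@cst01 (fun s => z s - k * s)) => //.
        apply: within_contB => // s; exact: ex_derive.
      move=> s s01; have := Dz s s01; rewrite (Hk s s01) => Ds.
      rewrite /isd; apply: is_derive_eq; rewrite /= /GRing.scale /=; ring.
    have [A HA] : exists k, forall t : R, t \in `]0 : R, 1 : R[ ->
        b * (z t * sin (b * t)) + al t 0 j * cos (b * t) = k.
      apply: cstoo => t t01; have Ds := Dz t t01; have Ds' := Dal t t01.
      rewrite /isd; apply: is_derive_eq; rewrite /= /GRing.scale /=; ring.
    have [B HB] : exists k, forall t : R, t \in `]0 : R, 1 : R[ ->
        z t * cos (b * t) - b^-1 * (al t 0 j * sin (b * t)) = k.
      apply: cstoo => t t01; have Ds := Dz t t01; have Ds' := Dal t t01.
      rewrite /isd; apply: is_derive_eq; rewrite /= /GRing.scale /=; by field.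
    have Ez t : t \in `]0 : R, 1 : R[ -> z t = A / b * sin (b * t) + B * cos (b * t).
      move=> t01; rewrite -(HA t t01) -(HB t t01).
      have := cos2Dsin2 (b * t); move: (cos (b * t)) (sin (b * t)) => C s E.
      by rewrite -[LHS]mulr1 -E; field.
    have Eal t : t \in `]0 : R, 1 : R[ -> al t 0 j = A * cos (b * t) - b * B * sin (b * t).
      move=> t01; rewrite -(HA t t01) -(HB t t01).
      have := cos2Dsin2 (b * t); move: (cos (b * t)) (sin (b * t)) => C s E.
      by rewrite -[LHS]mulr1 -E; field.
    have C t : t \in `[0 : R, 1 : R] -> z t - (A / b * sin (b * t) + B * cos (b * t)) = x1 0 j - B.
      move=> t01.
      have -> : x1 0 j - B = z 0 - (A / b * sin (b * 0) + B * cos (b * 0)).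
        by rewrite z0 mulr0 sin0 cos0; ring.
      apply: (@cst01 (fun s => z s - (A / b * sin (b * s) + B * cos (b * s)))) => //.
        apply: within_contB => // s; exact: ex_derive.
      move=> s s01; have := Dz s s01; rewrite (Eal s s01) => Ds.
      rewrite /isd; apply: is_derive_eq; rewrite /= /GRing.scale /=; by field.
    have EB : B = x1 0 j.
      by apply/eqP; rewrite eq_sym -subr_eq0 -(C (1/2)) // Ez // subrr.
    exists A => t t01; apply/eqP; rewrite -subr_eq0 -{1}EB C // EB subrr //.
  have [c Hc] := choice K.
  exists (\row_j c j) => t t01; apply/rowP => j.
  have := Hc j t t01; rewrite /y => ->; rewrite /gcurve.
  by case: eqP => _; rewrite /= !mxE; ring.
exists b, c => t t01.
have Dg (s : R) : is_derive s 1 (fun r => (gcurve x1 b c r).2) (dot (b *: (gcurve x1 b c s).1) (gcurve x1 b c s).1).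
  by have [+ _] := is_derive_gcurve x1 b c s; rewrite hcombE => /is_derive_coord[].
suff : (g t).2 - (gcurve x1 b c t).2 = (g 0).2 - (gcurve x1 b c 0).2.
  rewrite g0 gcurve0 subrr => /eqP; rewrite subr_eq0 => /eqP E.
  by move: E (Hc t t01); case: (g t) (gcurve _ _ _ t) => [p q] [p' q'] /= -> ->.
apply: (@cst01 (fun s => (g s).2 - (gcurve x1 b c s).2)) => //.
  by apply: within_contB => // r; have [] := Dg r.
move=> s s01; have Ds := Dw s s01; have Ds' := Dg s.
rewrite /isd; rewrite /isd; apply: is_derive_eq; rewrite Hc; last exact: subset_itv_oo_cc s01.
apply/eqP; rewrite subr_eq0; apply/eqP.
by rewrite /sqnorm /dot mulr_sumr; apply: eq_bigr => j _; rewrite !mxE mulrA.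
Unshelve. all: by end_near. Qed.

End GeodesicEquations.

(* Main.v *)
(* Write [h = b / 2], [A = (1 + a) / 2], [B = (1 - a) / 2] and
   [T = A tan h - B cot h]. Then [mu a b = (h T)'] and the squared length of the
   geodesic with parameter [b] is [2 (|x1|^2 + |x|^2) h^2 T']. For two solutions
   [h < k] of [(h T)' = m] with [d = k - h], Cauchy-Schwarz and [sin d < d] give
   [(T k - T h)^2 < d^2 T' h T' k], and the two equations turn this into
   [h^2 T' h < k^2 T' k]: lengths increase with [b]. Finiteness follows from
   Rolle's theorem applied repeatedly to the numerator of [mu a - m].

   For the lower bound on the distance, let [f b p] be the action from [x1] to
   [p] with multiplier [b], and [D p] the maximum of [f b p] over [0 <= b <= b*],
   where [b*] is the solution in (0, pi). Where the maximum is attained at [b],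
   the Hamilton-Jacobi equation bounds the horizontal gradient of [f b] by
   [2 sqrt (f b)], so that along a horizontal curve [sqrt D] has left Dini
   derivative at most the speed. As [sqrt (e^2 + D)] is absolutely continuous
   along the curve, its increment is at most the length; and [sqrt D] vanishes
   at the initial point while at [(x, u)] it is at least the length of the
   geodesic with parameter [b*]. *)

Require Import Defs.
From mathcomp Require Import all_boot all_order all_algebra.
From mathcomp Require Import all_classical all_reals all_analysis.
From mathcomp Require Import measurable_realfun ring lra.
Import Order.TTheory GRing.Theory Num.Theory.
Import numFieldNormedType.Exports.
Local Open Scope classical_set_scope.
Local Open Scope ring_scope.
Set Implicit Arguments.
Unset Strict Implicit.
Unset Printing Implicit Defensive.

(** * Strict growth of the length from one root to a larger one *)

Definition tancot (R : realType) (A B h : R) : R :=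
  A * (sin h / cos h) - B * (cos h / sin h).

(** The derivative of [tancot A B] in closed form. The comparison of roots uses only its algebra and
    its sign. *)
Definition tancot' (R : realType) (A B h : R) : R :=
  A / cos h ^+ 2 + B / sin h ^+ 2.

Lemma normr_sin_lt (R : realType) (x : R) : 0 < x -> `|sin x| < x.
Proof.
move=> x0; have [xpi|pix] := ltP x pi; last first.
  by rewrite (le_lt_trans (sin_max x))// (lt_le_trans _ pix)// (lt_le_trans _ (pi_ge2 R)) ?ltr1n.
have D (y : R) : y \in `]0, x[ -> is_derive y 1 (@sin R) (cos y).
  by move=> _; exact: is_derive_sin.
have C : {within `[0, x], continuous (@sin R)}.
  by apply: continuous_subspaceT => y; exact: continuous_sin.
have [c] := MVT x0 D C.
rewrite in_itv/= sin0 !subr0 => /andP[c0 cx] ->.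
rewrite normrM (gtr0_norm x0) gtr_pMl// lt_neqAle cos_max andbT norm_cos_eq1.
by rewrite gt_eqF// sin_gt0_pi// c0 (lt_trans cx).
Qed.

Lemma sin_sqr_lt (R : realType) (x : R) : 0 < x -> sin x ^+ 2 < x ^+ 2.
Proof.
move=> x0; rewrite -[sin x ^+ 2]real_normK ?num_real//.
by rewrite ltr_pXn2r ?nnegrE ?normr_ge0 ?(ltW x0) ?normr_sin_lt.
Qed.

Lemma tancotB (R : realType) (A B h k : R) :
  cos h != 0 -> sin h != 0 -> cos k != 0 -> sin k != 0 ->
  tancot A B k - tancot A B h =
  sin (k - h) * (A / (cos h * cos k) + B / (sin h * sin k)).
Proof.
move=> c1 s1 c2 s2; rewrite /tancot sinB; field.
by rewrite c1 s1 c2 s2.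
Qed.

Lemma tancot'_gt0 (R : realType) (A B h : R) : 0 < A -> 0 < B ->
  cos h != 0 -> sin h != 0 -> 0 < tancot' A B h.
Proof.
move=> A0 B0 c0 s0; by apply: addr_gt0; apply: divr_gt0; rewrite ?exprn_even_gt0.
Qed.

(** By [tancotB] the increment is [sin (k - h)] times [Q], the inner product of (sqrt A / cos, sqrt
    B / sin) at [h] and at [k]. Lagrange's identity shows the defect in Cauchy-Schwarz for [Q ^+ 2],
    and [sin_sqr_lt] makes the bound strict. *)
Lemma tancot_diff_sqr_lt (R : realType) (A B h k : R) : 0 < A -> 0 < B ->
  cos h != 0 -> sin h != 0 -> cos k != 0 -> sin k != 0 -> h < k ->
  (tancot A B k - tancot A B h) ^+ 2 <
  (k - h) ^+ 2 * (tancot' A B h * tancot' A B k).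
Proof.
move=> A0 B0 c1 s1 c2 s2 hk.
have kh : 0 < k - h by rewrite subr_gt0.
rewrite tancotB// exprMn.
set Q := A / _ + _.
have PQ : Q ^+ 2 <= tancot' A B h * tancot' A B k.
  rewrite -subr_ge0.
  have -> : tancot' A B h * tancot' A B k - Q ^+ 2 =
      A * B * ((cos h * sin k)^-1 - (cos k * sin h)^-1) ^+ 2.
    by rewrite /tancot' /Q; field; rewrite c1 s1 c2 s2.
  by apply: mulr_ge0; [apply: mulr_ge0; exact: ltW | exact: sqr_ge0].
have P0 : 0 < tancot' A B h * tancot' A B k.
  by rewrite mulr_gt0 ?tancot'_gt0.
apply: (@le_lt_trans _ _ (sin (k - h) ^+ 2 * (tancot' A B h * tancot' A B k))).
  by rewrite ler_wpM2l ?sqr_ge0.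
by rewrite ltr_pM2r// sin_sqr_lt.
Qed.

(* With [T] = tancot, [P] = tancot' and [d = k - h], the two root equations
   solve to [h (P h - P k) = T k - T h + d P k] and
   [k (P h - P k) = T k - T h + d P h]. *)
Lemma tancot_root_lt (R : realType) (A B h k m : R) : 0 < A -> 0 < B ->
  cos h != 0 -> sin h != 0 -> cos k != 0 -> sin k != 0 -> 0 < h -> h < k ->
  h * tancot' A B h + tancot A B h = m ->
  k * tancot' A B k + tancot A B k = m ->
  h ^+ 2 * tancot' A B h < k ^+ 2 * tancot' A B k.
Proof.
move=> A0 B0 c1 s1 c2 s2 h0 hk E1 E2.
have P1 := tancot'_gt0 A0 B0 c1 s1; have P2 := tancot'_gt0 A0 B0 c2 s2.
have := tancot_diff_sqr_lt A0 B0 c1 s1 c2 s2 hk.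
move: (tancot A B h) (tancot A B k) (tancot' A B h) (tancot' A B k) E1 E2 P1 P2.
move=> T1 T2 P1 P2 E1 E2 P10 P20.
set d := k - h => H.
have d0 : 0 < d by rewrite subr_gt0.
set Th := T2 - T1 in H.
have Eh : h * (P1 - P2) = Th + d * P2 by rewrite /Th /d; lra.
have Ek : k * (P1 - P2) = Th + d * P1 by rewrite /Th /d; lra.
(* If [P1 <= P2], then [Eh] gives [- Th >= d * P2], hence [Th ^+ 2 >= d ^+ 2 * (P1 * P2)], against
   [H]. Only [P2 < P1] survives. *)
have [P12|P12|P12] := ltgtP P1 P2.
- have Th0 : Th + d * P2 < 0 by rewrite -Eh pmulr_rlt0// subr_lt0.
  have : d * P2 < - Th by lra.
  have dP1 : 0 < d * P1 by rewrite mulr_gt0.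
  have dP2 : d * P1 < d * P2 by rewrite ltr_pM2l.
  move=> ThP; exfalso; move: H; apply/negP; rewrite -leNgt.
  rewrite (_ : _ * _ = (d * P1) * (d * P2)); last by ring.
  rewrite -sqrrN expr2 ler_pM//; lra.
(* The factor [(P1 - P2) ^+ 2] lets [Eh] and [Ek] eliminate [h] and [k]; the result is [P1 - P2]
   times the gap in [H]. *)
- rewrite -subr_gt0 -(pmulr_lgt0 _ (_ : 0 < (P1 - P2) ^+ 2)); last first.
    by rewrite exprn_gt0// subr_gt0.
  have -> : (k ^+ 2 * P2 - h ^+ 2 * P1) * (P1 - P2) ^+ 2 =
     (k * (P1 - P2)) ^+ 2 * P2 - (h * (P1 - P2)) ^+ 2 * P1 by ring.
  rewrite Eh Ek.
  have -> : (Th + d * P1) ^+ 2 * P2 - (Th + d * P2) ^+ 2 * P1 =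
    (P1 - P2) * (d ^+ 2 * (P1 * P2) - Th ^+ 2) by ring.
  by rewrite mulr_gt0// subr_gt0.
- exfalso; move: H; rewrite P12 in Eh *.
  have -> : Th = - (d * P2) by lra.
  rewrite sqrrN; lra.
Qed.

(** * Zeros of sine and finiteness of zero sets *)

Lemma sin_intpi (R : realType) (k : int) : sin (k%:~R * pi) = 0 :> R.
Proof.
have sn (m : nat) : sin (m%:R * pi) = 0 :> R.
  elim: m => [|m IH]; first by rewrite mul0r sin0.
  by rewrite -natr1 mulrDl mul1r sinDpi IH oppr0.
by case: k => m; rewrite ?NegzE -?pmulrn// mulrNz mulNr sinN sn oppr0.
Qed.

Lemma sin_eq0P (R : realType) (b : R) :
  sin b != 0 <-> forall k : int, b <> k%:~R * pi.
Proof.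
split=> [s0 k E|H]; first by rewrite E sin_intpi eqxx in s0.
(* The remainder of [b] modulo [pi] lies in [0, pi) and has sine [0], so it vanishes. *)
apply/negP => /eqP s0; set k := Num.floor (b / pi); apply: (H k).
have /andP[kb bk] := floor_itv (b / pi); have pi0 := pi_gt0 R.
have b1 : 0 <= b - k%:~R * pi by rewrite subr_ge0 -ler_pdivlMr.
have b2 : b - k%:~R * pi < pi.
  by rewrite ltrBlDl -{2}[pi]mul1r -mulrDl -ltr_pdivrMr// -intrD1.
have := sinB b (k%:~R * pi); rewrite s0 sin_intpi mul0r mulr0 subrr => E.
apply/eqP; rewrite -subr_eq0; move: b1; rewrite le_eqVlt => /predU1P[<-//|b1].
by have := @sin_gt0_pi R (b - k%:~R * pi); rewrite b1 b2 E ltxx => /(_ isT).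
Qed.

(** Points with equal integer parts are less than 1 apart, and sine is positive on (0, pi). So
    truncation is injective on [Z], with values bounded by that of [M]. *)
Lemma finite_sin_diff0 (R : realType) (Z : set R) (M : R) :
  (forall x, Z x -> 0 <= x <= M) ->
  (forall x y, Z x -> Z y -> sin (x - y) = 0) -> finite_set Z.
Proof.
move=> ZM Z0.
have inj : {in Z &, injective (@Num.trunc R)}.
  have H x y : Z x -> Z y -> Num.trunc x = Num.trunc y -> y <= x.
    move=> Zx Zy E; rewrite leNgt; apply/negP => xy.
    have /andP[x0 _] := ZM x Zx; have /andP[y0 _] := ZM y Zy.
    have /andP[x1 _] := truncn_itv x0; have /andP[_ y2] := truncn_itv y0.
    have : 0 < sin (y - x).
      apply: sin_gt0_pi; have := pi_ge2 R; rewrite E in x1; rewrite -natr1 in y2.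
      lra.
    by rewrite Z0// ltxx.
  move=> x y /set_mem Zx /set_mem Zy E; apply/eqP.
  by rewrite eq_le H//= H.
rewrite -(eq_finite_set (inj_card_eq inj)).
apply: (sub_finite_set _ (finite_II (Num.trunc M).+1)) => _ [x Zx <-] /=.
have /andP[x0 xM] := ZM x Zx.
by rewrite ltnS le_truncn.
Qed.

(* By Rolle, a zero of [f] is determined by which zeros of [f'] lie below it. *)
Lemma finite_zeros_derive (R : realType) (f f' : R -> R) (M : R) :
  (forall x : R, is_derive x 1 f (f' x)) ->
  finite_set [set x | 0 <= x <= M /\ f' x = 0] ->
  finite_set [set x | 0 <= x <= M /\ f x = 0].
Proof.
move=> df /finite_seqP[s Es]; set Z := [set x | _].
pose below (z : R) := map_tuple (fun w : R => (w < z)%R) (in_tuple s).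
suff inj : {in Z &, injective below}.
  rewrite -(eq_finite_set (inj_card_eq inj)); exact: finite_finset.
have H x y : Z x -> Z y -> x < y -> below x <> below y.
  move=> [x0 fx] [y0 fy] xy /(congr1 val)/= /eq_in_map E.
  have C : {within `[x, y], continuous f}.
    by apply: derivable_within_continuous => t _; case: (df t).
  have [c] := MVT xy (fun t _ => df t) C.
  rewrite in_itv/= fx fy subrr => /andP[xc cy] /esym/eqP.
  rewrite mulf_eq0 (subr_eq0 y) (gt_eqF xy) orbF => /eqP fc.
  have cs : c \in s.
    have : [set` s] c by rewrite -Es /=; split=> //; lra.
    by [].
  by have := E _ cs; rewrite cy ltNge (ltW xc).
move=> x y /set_mem Zx /set_mem Zy E; apply/eqP; rewrite eq_le !leNgt.
by apply/andP; split; apply/negP => /H; apply.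
Qed.

(** * The function [mu]: sign, bounds, level sets and monotonicity *)

(** [mu] is affine in [a]; for [-1 < a < 1] both weights are positive, so estimates reduce to the
    two quotients, the cases [a = 1] and [a = -1]. *)
Lemma muE (R : realType) (a b : R) : sin b != 0 ->
  mu a b = (1 + a) / 2 * ((b + sin b) / (1 + cos b)) +
           (1 - a) / 2 * ((b - sin b) / (1 - cos b)).
Proof.
move=> s0; rewrite /mu /cot.
have : sin b ^+ 2 != 0 by rewrite expf_neq0.
have E2 : sin b ^+ 2 = (1 + cos b) * (1 - cos b) by rewrite sin2cos2; ring.
rewrite E2 mulf_eq0 negb_or => /andP[c1 c2].
have -> : (b + sin b) / (1 + cos b) = (b + sin b) * (1 - cos b) / sin b ^+ 2.
  by rewrite E2; field; rewrite c1 c2.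
have -> : (b - sin b) / (1 - cos b) = (b - sin b) * (1 + cos b) / sin b ^+ 2.
  by rewrite E2; field; rewrite c1 c2.
by rewrite -E2; field.
Qed.

Lemma cos_lt1 (R : realType) (b : R) : sin b != 0 -> -1 < cos b < 1.
Proof. by rewrite -norm_cos_eq1 => c1; rewrite -ltr_norml lt_neqAle c1 cos_max. Qed.

(** For [b < 0] the bound |sin b| < |b| makes both numerators in [muE] negative. *)
Lemma mu_gt0 (R : realType) (a b : R) : -1 < a < 1 -> sin b != 0 ->
  0 < mu a b -> 0 < b.
Proof.
move=> /andP[a1 a2] s0; have /andP[c1 c2] := cos_lt1 s0.
rewrite muE//; apply: contraTT; rewrite -!leNgt le_eqVlt => /predU1P[b0|b0].
  by rewrite b0 sin0 eqxx in s0.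
have : `|sin (- b)| < - b by rewrite normr_sin_lt// oppr_gt0.
rewrite sinN normrN ltr_norml opprK => /andP[s1 s2].
have H1 : (b + sin b) / (1 + cos b) <= 0 by apply: mulr_le0_ge0; rewrite ?invr_ge0; lra.
have H2 : (b - sin b) / (1 - cos b) <= 0 by apply: mulr_le0_ge0; rewrite ?invr_ge0; lra.
rewrite -[leRHS]addr0; apply: lerD; apply: mulr_ge0_le0 => //; lra.
Qed.

(** Confines the roots of a given level to a bounded interval. In [muE] both numerators are positive
    and at least [b - 1], and both denominators are below 2. *)
Lemma mu_lower_bound (R : realType) (a b : R) : -1 < a < 1 -> sin b != 0 ->
  0 < b -> (b - 1) / 2 <= mu a b.
Proof.
move=> /andP[a1 a2] s0 b0; have /andP[c1 c2] := cos_lt1 s0.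
have := normr_sin_lt b0; rewrite ltr_norml => /andP[s1 s2].
have := sin_max b; rewrite ler_norml => /andP[s3 s4].
rewrite muE//.
have H (y z : R) : 0 < z < 2 -> 0 < y -> b - 1 <= y -> (b - 1) / 2 <= y / z.
  move=> /andP[z0 z2] y0 by1; apply: (@le_trans _ _ (y / 2)).
    by rewrite ler_pM2r// invr_gt0.
  by rewrite ler_pM2l// lef_pV2 ?posrE// ltW.
have H1 := H (b + sin b) (1 + cos b).
have H2 := H (b - sin b) (1 - cos b).
have {}H1 : (b - 1) / 2 <= (b + sin b) / (1 + cos b) by apply: H1; lra.
have {}H2 : (b - 1) / 2 <= (b - sin b) / (1 - cos b) by apply: H2; lra.
have -> : (b - 1) / 2 = (1 + a) / 2 * ((b - 1) / 2) + (1 - a) / 2 * ((b - 1) / 2) by field.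
by apply: lerD; apply: ler_wpM2l => //; lra.
Qed.

Lemma mul_cos_lt_sin (R : realType) (x : R) : 0 < x < pi -> x * cos x < sin x.
Proof.
move=> /andP[x0 xpi].
pose f (y : R) := sin y - y * cos y.
have df (y : R) : is_derive y 1 f (y * sin y).
  by apply: is_derive_eq; rewrite /= /GRing.scale /=; ring.
have C : {within `[0, x], continuous f}.
  by apply: derivable_within_continuous => t _; case: (df t).
have [c] := MVT x0 (fun t _ => df t) C.
rewrite in_itv/= {1 2}/f sin0 mul0r !subr0 => /andP[c0 cx] E.
rewrite -subr_gt0 E !mulr_gt0// sin_gt0_pi// c0/=; exact: lt_trans xpi.
Qed.

(** This is [mu a b - m] times [sin b ^+ 2]. It is smooth on the whole line, so Rolle's theorem and
    the intermediate value theorem apply across the poles of [mu]. *)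
Definition mu_num (R : realType) (a m b : R) : R :=
  b - sin b * cos b + a * (sin b - b * cos b) - m * (sin b * sin b).

Lemma muB (R : realType) (a m b : R) : sin b != 0 ->
  mu a b - m = mu_num a m b / sin b ^+ 2.
Proof. by move=> s0; rewrite /mu /cot /mu_num; field. Qed.

Lemma mu_num_eq0 (R : realType) (a m b : R) : sin b != 0 ->
  mu a b = m <-> mu_num a m b = 0.
Proof.
move=> s0; split=> [E|E]; last first.
  by apply/eqP; rewrite -subr_eq0 muB// E mul0r.
have := muB a m s0; rewrite E subrr => /esym/eqP.
by rewrite mulf_eq0 invr_eq0 expf_eq0/= (negbTE s0) orbF => /eqP.
Qed.

(** A factor [sin b] splits off; the other factor is trigonometric up to the linear term [a * b],
    which two further derivatives remove. *)
Lemma is_derive_mu_num (R : realType) (a m b : R) :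
  is_derive b 1 (mu_num a m) (sin b * (2 * sin b + a * b - 2 * m * cos b)).
Proof.
rewrite /mu_num; apply: is_derive_eq; rewrite /= /GRing.scale /=.
have := cos2Dsin2 b; move: (cos b) (sin b) => C s E.
have E1 : C ^+ 2 = 1 - s ^+ 2 by rewrite -E; ring.
by ring: E1.
Qed.

Lemma finite_mu_level (R : realType) (a m : R) : -1 < a < 1 -> 0 < m ->
  finite_set [set b : R | sin b != 0 /\ mu a b = m].
Proof.
(* By [mu_lower_bound] a root satisfies [(b - 1) / 2 <= m], that is [b <= M]. *)
move=> a1 m0; pose M := 2 * m + 1.
pose g (b : R) := 2 * sin b + a * b - 2 * m * cos b.
pose g' (b : R) := 2 * cos b + a + 2 * m * sin b.
pose g2 (b : R) := - 2 * sin b + 2 * m * cos b.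
have dg (b : R) : is_derive b 1 g (g' b).
  by apply: is_derive_eq; rewrite /g' /= /GRing.scale /=; ring.
have dg' (b : R) : is_derive b 1 g' (g2 b).
  by apply: is_derive_eq; rewrite /g2 /= /GRing.scale /=; ring.
(* Zeros of [g2] satisfy sin = m cos, so their differences have sine [0]. Finiteness then passes
   from [g2] to [g'], to [g], and finally to [mu_num]. *)
have F2 : finite_set [set b | 0 <= b <= M /\ g2 b = 0].
  apply: (@finite_sin_diff0 _ _ M) => [x []//|x y [_ x0] [_ y0]].
  have Ex : sin x = m * cos x by move: x0; rewrite /g2; lra.
  have Ey : sin y = m * cos y by move: y0; rewrite /g2; lra.
  by rewrite sinB Ex Ey; ring.
have F1 := finite_zeros_derive dg' F2.
have F0 := finite_zeros_derive dg F1.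
have Fs : finite_set [set b : R | 0 <= b <= M /\ sin b = 0].
  apply: (@finite_sin_diff0 _ _ M) => [x []//|x y [_ x0] [_ y0]].
  by rewrite sinB x0 y0; ring.
have F : finite_set [set b : R | 0 <= b <= M /\ sin b * g b = 0].
  apply: (@sub_finite_set _ _ ([set b : R | 0 <= b <= M /\ sin b = 0] `|`
     [set b : R | 0 <= b <= M /\ g b = 0])); last by rewrite finite_setU.
  by move=> x [xM] /eqP; rewrite mulf_eq0 => /orP[]/eqP; [left|right].
apply: sub_finite_set (finite_zeros_derive (is_derive_mu_num a m) F) => b [s0 E] /=.
have b0 : 0 < b by apply: (mu_gt0 a1 s0); rewrite E.
split; last exact/mu_num_eq0.
by have := mu_lower_bound a1 s0 b0; rewrite E /M; lra.
Qed.

(** [mu_num a m] vanishes at [0], so the intermediate value argument needs a positive left end where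
    it is negative; this bound, a consequence of b cos b < sin b < b, provides one. *)
Lemma mu_le2 (R : realType) (a b : R) : -1 < a < 1 -> 0 < b <= 1 / 2 ->
  mu a b <= 2 * b.
Proof.
move=> /andP[a1 a2] /andP[b0 b1]; have p1 := pihalf_ge1 R; have p2 := pi_ge2 R.
have s0 : 0 < sin b by apply: sin_gt0_pi; lra.
have c0 : 0 < cos b by apply: cos_gt0_pihalf; lra.
have /andP[_ c2] : -1 < cos b < 1 by apply: cos_lt1; rewrite gt_eqF.
have s1 : `|sin b| < b by exact: normr_sin_lt.
rewrite (gtr0_norm s0) in s1.
rewrite muE ?gt_eqF//.
have H1 : (b + sin b) / (1 + cos b) <= 2 * b.
  rewrite ler_pdivrMr; last by lra.
  have : 0 < b * cos b by rewrite mulr_gt0.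
  lra.
have H2 : (b - sin b) / (1 - cos b) <= 2 * b.
  rewrite ler_pdivrMr; last by lra.
  have : b * cos b < sin b by apply: mul_cos_lt_sin; lra.
  have : 0 < b * (1 - cos b) by rewrite mulr_gt0//; lra.
  lra.
have -> : 2 * b = (1 + a) / 2 * (2 * b) + (1 - a) / 2 * (2 * b) by field.
by apply: lerD; apply: ler_wpM2l => //; lra.
Qed.

Lemma mu_root_exists (R : realType) (a m : R) : -1 < a < 1 -> 0 < m ->
  exists2 b : R, 0 < b < pi & mu a b = m.
Proof.
move=> a1 m0; have p2 := pi_ge2 R.
(* [1 / 2] serves [mu_le2], and [m / 4] turns its bound into [mu a b0 <= m / 2]. *)
pose b0 : R := Num.min (1 / 2) (m / 4).
have b01 : b0 <= 1 / 2 by rewrite ge_min lexx.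
have b02 : b0 <= m / 4 by rewrite ge_min lexx orbT.
have b00 : 0 < b0 by rewrite lt_min; apply/andP; split; lra.
have s0 : 0 < sin b0 by apply: sin_gt0_pi; lra.
have F0 : mu_num a m b0 < 0.
  have := @mu_le2 _ a b0 a1; rewrite b00 b01 => /(_ isT) H.
  have : mu a b0 - m < 0 by lra.
  by rewrite muB ?gt_eqF// pmulr_llt0// invr_gt0 exprn_gt0.
(* At [pi], a pole of [mu], the numerator is [(1 + a) * pi]. *)
have Fpi : 0 < mu_num a m pi.
  rewrite /mu_num sinpi cospi !mul0r mulr0 !subr0 sub0r mulrN1 opprK.
  have := pi_gt0 R; move: a1 => /andP[a1 _] pi0.
  have : 0 < (1 + a) * pi by rewrite mulr_gt0//; lra.
  lra.
have bpi : b0 <= pi by lra.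
have C : {within `[b0, pi], continuous (mu_num a m)}.
  by apply: derivable_within_continuous => t _; case: (is_derive_mu_num a m t).
have [|c] := IVT (v := 0) bpi C.
  by rewrite ge_min le_max (ltW F0) (ltW Fpi) orbT.
rewrite in_itv/= => /andP[c0 cpi] Ec.
have {}cpi : c < pi.
  by rewrite lt_neqAle cpi andbT; apply/eqP => E; rewrite E in Ec; rewrite Ec ltxx in Fpi.
have c00 : 0 < c by lra.
exists c; first by rewrite c00 cpi.
by apply/mu_num_eq0 => //; rewrite gt_eqF// sin_gt0_pi// c00.
Qed.

(** Grouped by the weights [1 - a] and [1 + a], so that [mu_incr] can settle the sign of each
    summand separately. *)
Lemma is_derive_mu (R : realType) (a b : R) : sin b != 0 ->
  is_derive b 1 (mu a)
    (((1 - a) / 2 * ((1 + cos b) * (2 * sin b - b * (1 + cos b))) +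
      (1 + a) / 2 * ((1 - cos b) * (2 * sin b + b * (1 - cos b)))) / sin b ^+ 3).
Proof.
move=> s0; rewrite /mu /cot.
have dV : is_derive b 1 (fun y : R => (sin y)^-1) (- (sin b) ^- 2 * cos b).
  exact: is_deriveV.
rewrite (_ : (fun b0 : R => _) = (fun y : R => y * ((sin y)^-1 * (sin y)^-1) -
   cos y * (sin y)^-1 + a * ((sin y)^-1 - y * cos y * ((sin y)^-1 * (sin y)^-1)))); last first.
  by apply/funext => y; rewrite -expr2 -exprVn; ring.
apply: is_derive_eq; rewrite /= /GRing.scale /=.
have := cos2Dsin2 b; move: (cos b) (sin b) s0 => C s s0 E.
have E1 : C ^+ 2 = 1 - s ^+ 2 by rewrite -E; ring.
by field: E1.
Qed.

Lemma mu_incr (R : realType) (a b1 b2 : R) : -1 < a < 1 ->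
  0 < b1 -> b1 < b2 -> b2 < pi -> mu a b1 < mu a b2.
Proof.
move=> /andP[a1 a2] b0 b12 bpi.
have s0 (t : R) : b1 <= t <= b2 -> 0 < sin t.
  by move=> t12; apply: sin_gt0_pi; lra.
have D (t : R) (t12 : b1 <= t <= b2) := is_derive_mu a (lt0r_neq0 (s0 t t12)).
have C : {within `[b1, b2], continuous (mu a)}.
  by apply: derivable_within_continuous => t; rewrite in_itv/= => /D[].
have D' t : t \in `]b1, b2[ -> is_derive t 1 (mu a) _ := fun tb => D t (subset_itv_oo_cc tb).
have [c] := MVT b12 D' C.
rewrite in_itv/= => /andP[c1 c2] E.
have sc : 0 < sin c by apply: s0; lra.
have /andP[k1 k2] : -1 < cos c < 1 by apply: cos_lt1; rewrite gt_eqF.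
have c0 : 0 < c by lra.
rewrite -subr_gt0 E mulr_gt0 ?subr_gt0//; apply: divr_gt0; last by rewrite exprn_gt0.
have Q : 0 < (1 - cos c) * (2 * sin c + c * (1 - cos c)).
  have : 0 < c * (1 - cos c) by rewrite mulr_gt0//; lra.
  by move=> ?; rewrite mulr_gt0//; lra.
(* With [h = c / 2] the second factor is [4 * (cos h * (sin h - h * cos h))], positive by
   [mul_cos_lt_sin]. *)
have P : 0 < (1 + cos c) * (2 * sin c - c * (1 + cos c)).
  rewrite mulr_gt0//; first by lra.
  have hc : c / 2 * cos (c / 2) < sin (c / 2) by apply: mul_cos_lt_sin; lra.
  have ch : 0 < cos (c / 2) by apply: cos_gt0_pihalf; lra.
  have -> : c = (c / 2) *+ 2 by rewrite -mulr_natr; field.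
  rewrite sin_mulr2n cos_mulr2n; set h := c / 2 in ch hc *.
  have -> : 2 * ((cos h * sin h) *+ 2) - h *+ 2 * (1 + (cos h ^+ 2 *+ 2 - 1)) =
    4 * (cos h * (sin h - h * cos h)) by ring.
  by rewrite !mulr_gt0// subr_gt0.
by apply: addr_gt0; apply: mulr_gt0 => //; lra.
Qed.

(** * Half-angle forms of the level equation and of the squared length *)

Lemma half_neq0 (R : realType) (b : R) : sin b != 0 ->
  cos (b / 2) != 0 /\ sin (b / 2) != 0.
Proof.
rewrite {1}(_ : b = (b / 2) *+ 2); last by rewrite -mulr_natr; field.
rewrite sin_mulr2n mulrn_eq0/= mulf_eq0 negb_or => /andP[]; exact.
Qed.

Lemma mu_tancot (R : realType) (a b : R) : sin b != 0 ->
  mu a b = b / 2 * tancot' ((1 + a) / 2) ((1 - a) / 2) (b / 2) +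
           tancot ((1 + a) / 2) ((1 - a) / 2) (b / 2).
Proof.
move=> s0; have [c1 s1] := half_neq0 s0; rewrite muE//.
set h := b / 2 in c1 s1 *.
have -> : b = h *+ 2 by rewrite -mulr_natr /h; field.
rewrite sin_mulr2n cos_mulr2n /tancot /tancot'.
have -> : 1 + (cos h ^+ 2 *+ 2 - 1) = 2 * cos h ^+ 2 by ring.
have -> : 1 - (cos h ^+ 2 *+ 2 - 1) = 2 * sin h ^+ 2 by rewrite sin2cos2; ring.
by field; rewrite c1 s1.
Qed.

(** The left side is the squared length of the geodesic with parameter [b], divided by |x1|^2 +
    |x|^2. *)
Lemma speed_tancot' (R : realType) (a b : R) : sin b != 0 ->
  (b / sin b) ^+ 2 * (1 - a * cos b) =
  2 * ((b / 2) ^+ 2 * tancot' ((1 + a) / 2) ((1 - a) / 2) (b / 2)).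
Proof.
move=> s0; have [c1 s1] := half_neq0 s0.
set h := b / 2 in c1 s1 *.
have -> : b = h *+ 2 by rewrite -mulr_natr /h; field.
rewrite sin_mulr2n cos_mulr2n /tancot'.
have E := cos2Dsin2 h.
have -> : 1 - a * (cos h ^+ 2 *+ 2 - 1) =
   (1 + a) * sin h ^+ 2 + (1 - a) * cos h ^+ 2 by rewrite sin2cos2; ring.
by field; rewrite c1 s1.
Qed.

Lemma mu_speed_lt (R : realType) (a b b' : R) : -1 < a < 1 ->
  sin b != 0 -> sin b' != 0 -> 0 < b -> b < b' -> mu a b = mu a b' ->
  (b / sin b) ^+ 2 * (1 - a * cos b) < (b' / sin b') ^+ 2 * (1 - a * cos b').
Proof.
move=> /andP[a1 a2] s0 s0' b0 bb'; rewrite !mu_tancot// !speed_tancot'// => E.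
have [c1 s1] := half_neq0 s0; have [c1' s1'] := half_neq0 s0'.
rewrite ltr_pM2l//; apply: (tancot_root_lt _ _ c1 s1 c1' s1' _ _ E erefl) => //; lra.
Qed.

(** * Absolute continuity along ordered lists of intervals *)

(** An ordered list can be extended at its left end by [::]. Confinement to [U] bounds the total
    length by the measure of [U]. *)
Fixpoint subdivision (R : realType) (U : set R) (lo : R) (l : seq (R * R)) : Prop :=
  if l is ab :: l' then
    [/\ lo <= ab.1, ab.1 <= ab.2, `[ab.1, ab.2] `<=` U & subdivision U ab.2 l']
  else lo <= 1.

Definition total_length (R : realType) (l : seq (R * R)) : R :=
  \sum_(ab <- l) (ab.2 - ab.1).

Definition total_variation_on (R : realType) (V : normedModType R) (g : R -> V)
  (l : seq (R * R)) : R := \sum_(ab <- l) `|g ab.2 - g ab.1|.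

Definition seq_abs_continuous (R : realType) (V : normedModType R) (g : R -> V) : Prop :=
  forall e : R, 0 < e -> exists2 d : R, 0 < d &
    forall l, subdivision setT 0 l -> total_length l < d ->
      total_variation_on g l < e.

Lemma subdivision_le1 (R : realType) (U : set R) (lo : R) (l : seq (R * R)) :
  subdivision U lo l -> lo <= 1.
Proof.
elim: l lo => [//|ab l IH] lo /= [la ab12 _ /IH b1].
exact: le_trans la (le_trans ab12 b1).
Qed.

Lemma subdivisionW (R : realType) (U V : set R) (lo lo' : R) (l : seq (R * R)) :
  U `<=` V -> lo' <= lo -> subdivision U lo l -> subdivision V lo' l.
Proof.
move=> UV; elim: l lo lo' => [|ab l IH] lo lo' /= lo'lo; first exact: le_trans.
move=> [la ab12 abU H]; split => //; first exact: le_trans la.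
  exact: subset_trans UV.
exact: IH H.
Qed.

Lemma subdivision_nth (R : realType) (lo : R) (l : seq (R * R)) (x0 : R * R) :
  subdivision setT lo l ->
  (forall i, (i < size l)%N ->
    [/\ lo <= (nth x0 l i).1, (nth x0 l i).1 <= (nth x0 l i).2 & (nth x0 l i).2 <= 1]) /\
  (forall i j, (i < j < size l)%N -> (nth x0 l i).2 <= (nth x0 l j).1).
Proof.
elim: l lo => [|ab l IH] lo /=; first by split=> // i j; rewrite ltn0 andbF.
move=> [la ab12 _ H]; have b1 := subdivision_le1 H.
have [H1 H2] := IH _ H; split => [[|i]|[|i] [|j]] //=.
  move=> /H1[h1 h2 h3]; split=> //; apply: le_trans h1; exact: le_trans ab12.
- by rewrite ltnS => /H1[].
- by rewrite ltnS; exact: H2.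
Qed.

Lemma abs_continuous01_seq (R : realType) (n : nat) (g : R -> 'rV[R]_n * R) :
  abs_continuous01 g -> seq_abs_continuous g.
Proof.
move=> H e /H[d d0 Hd]; exists d => // l l01 ld.
have [H1 H2] := subdivision_nth (0, 0) l01.
have := Hd (size l) (fun i => (nth (0, 0) l i).1) (fun i => (nth (0, 0) l i).2).
rewrite /total_length (big_nth (0, 0)) big_mkord in ld.
rewrite /total_variation_on (big_nth (0, 0)) big_mkord; apply => //.
  by move=> i; have [] := H1 i (ltn_ord i).
have disj (i j : 'I_(size l)) (x : R) : (i < j)%N -> (nth (0, 0) l i).1 < x < (nth (0, 0) l i).2 ->
    ~~ ((nth (0, 0) l j).1 < x < (nth (0, 0) l j).2).
  move=> ij /andP[_ x1]; apply/negP => /andP[x2 _].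
  have := H2 i j; rewrite ij ltn_ord => /(_ isT) ij'.
  by have := lt_trans x1 (le_lt_trans ij' x2); rewrite ltxx.
move=> i j _ _ [x []]; rewrite /= !in_itv/= => xi xj; apply/eqP/negPn/negP.
rewrite neq_ltn => /orP[ij|ji]; first by move: (disj i j x ij xi); rewrite xj.
by move: (disj j i x ji xj); rewrite xi.
Qed.

Lemma lipschitz_seq_abs_continuous (R : realType) (V W : normedModType R)
    (g : R -> V) (K : R -> W) (C : R) :
  (forall s t : R, 0 <= s -> s <= t -> t <= 1 -> `|K t - K s| <= C * `|g t - g s|) ->
  seq_abs_continuous g -> seq_abs_continuous K.
Proof.
(* [C] may be zero or negative; [C'] is a positive bound to divide by. *)
move=> KC H e e0; pose C' := `|C| + 1.
have C'0 : 0 < C' by rewrite ltr_wpDl.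
have [d d0 Hd] := H (e / C') (divr_gt0 e0 C'0); exists d => // l l01 ld.
have := Hd l l01 ld; rewrite ltr_pdivlMr// mulrC; apply: le_lt_trans.
rewrite /total_variation_on mulr_sumr.
have [H1 _] := subdivision_nth (0, 0) l01.
rewrite big_seq [leRHS]big_seq; apply: ler_sum => ab abl.
rewrite -(nth_index (0, 0) abl).
have [h1 h2 h3] := H1 (index ab l) (etrans (index_mem ab l) abl).
apply: le_trans (KC _ _ h1 h2 h3) _; apply: ler_wpM2r => //.
by rewrite (le_trans (ler_norm C))// /C' lerDl.
Qed.

Lemma seq_abs_continuous_near (R : realType) (V : normedModType R) (g : R -> V) :
  seq_abs_continuous g -> forall e : R, 0 < e -> exists2 d : R, 0 < d &
    forall s t : R, 0 <= s -> s <= t -> t <= 1 -> t - s < d -> `|g t - g s| < e.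
Proof.
move=> H e /H[d d0 Hd]; exists d => // s t s0 st t1 std.
have := Hd [:: (s, t)]; rewrite /total_length /total_variation_on !big_seq1/=.
by apply.
Qed.

(** Half-open intervals keep neighbours with a common endpoint disjoint, so that measures add up
    along the list. *)
Lemma total_length_le (R : realType) (U : set R) (lo : R) (l : seq (R * R)) :
  open U -> subdivision U lo l ->
  ((total_length l)%:E <= lebesgue_measure (U `&` `]lo, 1%R]))%E.
Proof.
move=> oU; elim: l lo => [|ab l IH] lo /=.
  by move=> _; rewrite /total_length big_nil.
move=> [la ab12 abU H]; have b1 := subdivision_le1 H.
have mU : measurable U by exact: open_measurable.
rewrite /total_length big_cons -/(total_length l) EFinD.
apply: (@le_trans _ _ (lebesgue_measure (`]ab.1, ab.2] `|` (U `&` `]ab.2, 1%R])))).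
  rewrite measureU//; last 2 first.
  - by apply: measurableI.
  - rewrite -subset0 => x [/=]; rewrite !in_itv/= => /andP[_ x1] [_ /andP[x2 _]].
    by move: (lt_le_trans x2 x1); rewrite ltxx.
  apply: leeD; last exact: IH.
  rewrite [leRHS](lebesgue_measure_itv `]ab.1, ab.2])/= lte_fin; case: ltgtP ab12 => // -> _.
  by rewrite subrr.
apply: le_measure; rewrite ?inE//.
- by apply: measurableU => //; apply: measurableI.
- by apply: measurableI.
move=> x [|[Ux]] /=; rewrite !in_itv/= => /andP[x1 x2].
  split; first by apply: abU; rewrite /= in_itv/= (ltW x1).
  by rewrite (le_lt_trans la x1) (le_trans x2 b1).
by split=> //; rewrite (le_lt_trans (le_trans la ab12) x1).
Qed.

(* The set of good [t] is propagated from 1 down to 0: off [N] by the local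
   estimate, near [N] by charging the variation of [K] to an open set [U]
   of small measure containing [N]. *)
Lemma abs_continuous_increment_le (R : realType) (K I : R -> R) (N : set R) :
  seq_abs_continuous (K : R -> R^o) ->
  (forall s t : R, 0 <= s -> s <= t -> t <= 1 -> I s <= I t) ->
  lebesgue_measure.-negligible N ->
  (forall t : R, 0 < t <= 1 -> ~ N t -> forall e : R, 0 < e ->
    exists s : R, [/\ 0 <= s, s < t & K t - K s <= I t - I s + e * (t - s)]) ->
  K 1 - K 0 <= I 1 - I 0.
Proof.
move=> acK Imono [A [mA A0 NA]] loc.
suff H e : 0 < e -> K 1 - K 0 <= I 1 - I 0 + e.
  apply/ler_addgt0Pr => e e0; exact: H.
(* One third each for the local errors, the variation inside [U] and the slack [eta]. *)
move=> e0; have e3 : 0 < e / 3 by rewrite divr_gt0.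
have [d d0 Hd] := acK _ e3.
have [U [oU AU UAd]] : exists U : set R, [/\ open U, A `<=` U &
    (lebesgue_measure (U `\` A) < d%:E)%E].
  by apply: lebesgue_regularity_outer => //; rewrite [X in (X < _)%E]A0.
have mU : measurable U by exact: open_measurable.
have Ud : (lebesgue_measure U < d%:E)%E.
  have := @outer_measureU2 _ _ (@lebesgue_measure R) A (U `\` A).
  rewrite setDUK//= [X in (_ <= X + _)%E -> _]A0 add0e => /le_lt_trans; exact.
pose Q (t : R) := 0 <= t <= 1 /\ forall eta : R, 0 < eta -> exists2 l,
  subdivision U t l & K 1 - K t <=
      I 1 - I t + e / 3 * (1 - t) + total_variation_on (K : R -> R^o) l + eta.
have Q1 : Q 1.
  split=> [|eta eta0]; first by rewrite ler01 lexx.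
  by exists [::] => //=; rewrite /total_variation_on big_nil; lra.
have lbQ : lbound Q 0 by move=> t [/andP[]].
have hiQ : has_inf Q by split; [exists 1|exists 0].
pose t0 := inf Q.
have t00 : 0 <= t0 by apply: lb_le_inf => //; exists 1.
have t01 : t0 <= 1 by apply: ge_inf => //; exists 0.
(* The slack makes [Q] contain its infimum: a short move to the left changes [K] by less than
   [eta / 2], and [I] does not increase. *)
have Qt0 : Q t0.
  split=> [|eta eta0]; first by rewrite t00.
  have eta2 : 0 < eta / 2 by rewrite divr_gt0.
  have [d' d'0 Hd'] := seq_abs_continuous_near acK eta2.
  have [t [/andP[t_ge0 t1] Qt] tt0] := inf_adherent d'0 hiQ.
  have t0t : t0 <= t.
    by apply: ge_inf; [exists 0|split=> //; rewrite t_ge0].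
  have [l lt Hl] := Qt _ eta2.
  exists l; first exact: (@subdivisionW _ U _ t).
  have := Hd' t0 t t00 t0t t1; rewrite -/t0 in tt0; rewrite ltrBlDl => /(_ tt0).
  rewrite ltr_norml => /andP[k1 k2].
  have := Imono t0 t t00 t0t t1.
  have : e / 3 * (1 - t) <= e / 3 * (1 - t0) by rewrite ler_pM2l//; lra.
  lra.
suff t0E : t0 = 0.
  move: Qt0; rewrite t0E => -[_ /(_ _ e3)[l l0 Hl]].
  have l01 : subdivision setT 0 l by exact: subdivisionW l0.
  have : total_length l < d.
    rewrite -lte_fin; apply: le_lt_trans (total_length_le oU l0) _.
    apply: le_lt_trans Ud; apply: le_measure; rewrite ?inE//; exact: measurableI.
  move=> /(Hd l l01) Hv; lra.
apply/eqP; rewrite eq_le t00 andbT leNgt; apply/negP => t0gt0.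
have [_ Qt0'] := Qt0.
suff [s st0 Qs] : exists2 s, s < t0 & Q s.
  by have := ge_inf (ex_intro _ 0 lbQ) Qs; rewrite leNgt st0.
have [Ut0|nUt0] := pselect (U t0).
  have /nbhs_ballP[r /= r0 rU] : nbhs t0 U by exact: open_nbhs_nbhs.
  pose s := Num.max 0 (t0 - r / 2).
  have s0 : 0 <= s by rewrite le_max lexx.
  have sr : t0 - r / 2 <= s by rewrite le_max lexx orbT.
  have st0 : s < t0 by rewrite gt_max t0gt0/= ltrBlDr ltrDl divr_gt0.
  exists s => //; split=> [|eta /Qt0'[l lt0 Hl]].
    by rewrite s0 (le_trans (ltW st0)).
  exists ((s, t0) :: l) => /=.
    split=> //; first exact: ltW.
    move=> x /=; rewrite in_itv/= => /andP[sx xt0]; apply: rU.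
    rewrite /ball/= ltr_norml; move: (r0) => /= r0'; apply/andP; split; lra.
  rewrite /total_variation_on big_cons -/(total_variation_on (K : R -> R^o) l)/=.
  have := Imono s t0 s0 (ltW st0) t01.
  have : e / 3 * (1 - t0) <= e / 3 * (1 - s) by rewrite ler_pM2l//; lra.
  have := ler_norm (K t0 - K s); lra.
have nNt0 : ~ N t0 by move=> /NA /AU.
have t0in : 0 < t0 <= 1 by rewrite t0gt0.
have [s [s0 st0 Hs]] := loc t0 t0in nNt0 _ e3.
exists s => //; split=> [|eta /Qt0'[l lt0 Hl]].
  by rewrite s0 (le_trans (ltW st0)).
exists l; first exact: subdivisionW (ltW st0) lt0.
lra.
Qed.

(** * Integrating a bound on left difference quotients *)

(** Here [f] is an arbitrary nonnegative function, such as the speed of a curve, and its integral is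
    the supremum over simple functions below it. A simple function below [g], cut off on the null
    set, lies below [f]. *)
Lemma ge0_ae_le_lower_integral d (T : measurableType d) (R : realType)
    (mu : {measure set T -> \bar R}) (D : set T) (g f : T -> \bar R) :
  measurable D -> measurable_fun D g ->
  (forall x, D x -> (0 <= g x)%E) -> (forall x, D x -> (0 <= f x)%E) ->
  {ae mu, forall x, D x -> (g x <= f x)%E} ->
  (\int[mu]_(x in D) g x <= \int[mu]_(x in D) f x)%E.
Proof.
move=> mD mg g0 f0 [N [mN N0 gfN]].
rewrite (ge0_negligible_integral mN mD mg g0 N0).
rewrite !ge0_integralE//; last by move=> x [Dx _]; exact: g0.
apply: le_ereal_sup => _ [h hg <-]; exists h => // x.
apply: le_trans (hg x) _; rewrite !patchE.
case: ifPn => [/set_mem[Dx nNx]|_].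
  rewrite mem_set//; move: nNx; apply: contra_notT => gf.
  by apply: gfN => /= /(_ Dx); apply/negP.
by case: ifPn => // /set_mem; exact: f0.
Qed.

Lemma limn_esup_lt_near (R : realType) (u : (\bar R)^nat) (c : \bar R) :
  (limn_esup u < c)%E -> \forall n \near \oo, (u n < c)%E.
Proof.
rewrite limn_esup_lim (cvg_lim _ (@cvg_esups_inf _ u))// => /ereal_inf_lt[_ [n _ <-] unc].
exists n => // m /= nm; apply: le_lt_trans unc; apply: ereal_sup_ubound.
by exists m.
Qed.

Lemma limn_esup_le_near (R : realType) (u : (\bar R)^nat) (c : \bar R) :
  (\forall n \near \oo, (u n <= c)%E) -> (limn_esup u <= c)%E.
Proof.
rewrite limn_esup_lim (cvg_lim _ (@cvg_esups_inf _ u))// => -[n _ unc].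
apply: (@le_trans _ _ (esups u n)); first by apply: ereal_inf_lbound; exists n.
by apply: ge_ereal_sup => _ [m /= nm <-]; exact: unc.
Qed.

Lemma is_derive_left_seq (R : realType) (f : R -> R) (t d e : R) :
  is_derive t 1 f d -> 0 < e -> \forall k \near \oo,
    `|f t - f (t - k.+1%:R^-1) - d * k.+1%:R^-1| <= e * k.+1%:R^-1.
Proof.
move=> [df <-] e0; have /cvgrPdist_le/(_ e e0) := df.
move=> /nbhs_ballP[r /= r0 Hr]; apply: filterS (near_infty_natSinv_lt (PosNum r0)) => k /= kr.
have k0 : 0 < k.+1%:R^-1 :> R by rewrite invr_gt0.
have := Hr (- k.+1%:R^-1); rewrite /ball/= sub0r opprK gtr0_norm// kr oppr_eq0 gt_eqF//.
move=> /(_ isT isT); rewrite scaler1 invrN invrK /= [- _ + t]addrC.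
move=> H; rewrite -ler_pdivrMr// -[X in _ / X]gtr0_norm// -normf_div.
apply: le_trans H; rewrite le_eqVlt; apply/orP; left; apply/eqP.
rewrite -normrN; congr `|_|; rewrite invrK /GRing.scale/= mulrBl -mulrA mulVf ?pnatr_eq0//.
by rewrite /derive/=; ring.
Qed.

(** Composition with it extends a function continuously from [0, 1] to the line, which makes its
    difference quotients measurable. *)
Definition clamp01 (R : realType) (t : R) : R := Num.max 0 (Num.min 1 t).

Lemma clamp01_itv (R : realType) (t : R) : 0 <= clamp01 t <= 1.
Proof. by rewrite /clamp01 le_max lexx/= ge_max ler01 ge_min lexx. Qed.

Lemma clamp01_id (R : realType) (t : R) : 0 <= t <= 1 -> clamp01 t = t.
Proof. by move=> /andP[t0 t1]; rewrite /clamp01 (min_idPr t1) (max_idPr t0). Qed.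

Lemma clamp01_homo (R : realType) (s t : R) : s <= t ->
  clamp01 s <= clamp01 t <= clamp01 s + (t - s).
Proof.
rewrite /clamp01 !minEle !maxEle => st.
case: (leP 1 s) => s1; case: (leP 1 t) => t1; rewrite ?ler01;
case: (leP 0 s) => s0; case: (leP 0 t) => t0; apply/andP; split; lra.
Qed.

Lemma seq_abs_continuous_clamp (R : realType) (K : R -> R) :
  seq_abs_continuous (K : R -> R^o) -> continuous (K \o @clamp01 R).
Proof.
move=> acK t; apply/cvgrPdist_lt => e e0.
have [d d0 Hd] := seq_abs_continuous_near acK e0.
near=> s; have std : `|t - s| < d by near: s; exact: (@cvgr_dist_lt _ _ _ (nbhs t)).
have /andP[s0 s1] := clamp01_itv s; have /andP[t0 t1] := clamp01_itv t.
have [st|/ltW ts] := leP s t.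
  have /andP[h1 h2] := clamp01_homo st; apply: Hd => //.
  rewrite ger0_norm ?subr_ge0// in std; lra.
have /andP[h1 h2] := clamp01_homo ts; rewrite distrC; apply: Hd => //.
rewrite distrC ger0_norm ?subr_ge0// in std; lra.
Unshelve. all: by end_near. Qed.

(** The positive part [w] of the upper limit of the left quotients of [K] is measurable and almost
    everywhere at most [f]. If [f] has finite integral, the primitive [I] of [w] has derivative [w]
    almost everywhere, and [abs_continuous_increment_le] compares [K] with [I]. *)
Lemma abs_continuous_le_integral (R : realType) (K : R -> R) (f : R -> \bar R) :
  seq_abs_continuous (K : R -> R^o) -> (forall t, (0 <= f t)%E) ->
  {ae lebesgue_measure, forall t : R, t \in `]0 : R, 1 : R[ ->
    forall y : R, (f t < y%:E)%E ->
    \forall k \near \oo, K t - K (t - k.+1%:R^-1) <= y * k.+1%:R^-1} ->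
  ((K 1 - K 0)%:E <= \int[lebesgue_measure]_(t in `[0%R, 1%R]) f t)%E.
Proof.
move=> acK f0 Hf.
set J := (X in (_ <= X)%E).
have [->|Jy] := eqVneq J +oo%E; first by rewrite leey.
have {}Jy : (J < +oo)%E by rewrite ltey.
pose K' := K \o @clamp01 R.
have K'E t k : t \in `]0 : R, 1 : R[ -> k.+1%:R^-1 < t ->
    K' t - K' (t - k.+1%:R^-1) = K t - K (t - k.+1%:R^-1).
  rewrite in_itv/= => /andP[t0 t1] kt; rewrite /K'/= !clamp01_id//.
    by rewrite subr_ge0 ltW//= lerBlDr ler_wpDr ?invr_ge0// ltW.
  by rewrite !ltW.
have near0 t : t \in `]0 : R, 1 : R[ -> \forall k \near \oo, k.+1%:R^-1 < t.
  by rewrite in_itv/= => /andP[t0 _]; exact: near_infty_natSinv_lt (PosNum t0).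
have cK' : continuous K' by exact: seq_abs_continuous_clamp.
pose q (k : nat) (t : R) := ((K' t - K' (t - k.+1%:R^-1)) * k.+1%:R)%:E.
have mq k : measurable_fun [set: R] (q k).
  apply/measurable_EFinP; apply: measurable_funM => //; apply: measurable_funB.
    exact: continuous_measurable_fun.
  apply: measurableT_comp; first exact: continuous_measurable_fun.
  exact: measurable_funB.
pose w (t : R) : \bar R := maxe (limn_esup (q^~ t)) 0.
have mw : measurable_fun [set: R] w.
  by apply: measurable_maxe => //; exact: measurable_fun_limn_esup.
pose g := w \_ (`]0 : R, 1 : R[).
have mg : measurable_fun [set: R] g.
  by apply/(measurable_restrictT w) => //; exact: measurable_funTS.
have g0 t : (0 <= g t)%E.
  by rewrite /g patchE; case: ifPn => // _; rewrite /w le_max lexx orbT.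
have gf : {ae lebesgue_measure, forall t : R, [set` `[0 : R, 1 : R]] t -> (g t <= f t)%E}.
  apply: (@filterS _ _ (ae_filter_ringOfSetsType _) _ _ _ Hf) => t Ht _.
  rewrite /g patchE; case: ifPn => // /set_mem t01.
  rewrite /w ge_max f0 andbT.
  have := f0 t; case: (f t) (Ht t01) => [r Hr _|_ _|//]; last by rewrite leey.
  apply/lee_addgt0Pr => e e0; apply: limn_esup_le_near.
  have Hre := Hr (r + e); rewrite lte_fin ltrDl in Hre.
  apply: filterS2 (Hre e0) (near0 t t01) => k Hk tk.
  by rewrite /q lee_fin K'E// -ler_pdivlMr.
have gJ : (\int[lebesgue_measure]_(t in `[0%R, 1%R]) g t <= J)%E.
  apply: ge0_ae_le_lower_integral => //; exact: measurable_funTS.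
(* [fine] sends infinite values to [0]; as [g] is integrable, they occur only on a null set. *)
pose G := fine \o g.
have G0 t : 0 <= G t by exact: fine_ge0.
have Gg t : ((G t)%:E <= g t)%E.
  by rewrite /G/=; have := g0 t; case: (g t) => //= _; rewrite leey.
have gT : (\int[lebesgue_measure]_t g t = \int[lebesgue_measure]_(t in `[0%R, 1%R]) g t)%E.
  rewrite [RHS]integral_mkcond; apply: eq_integral => t _; rewrite patchE.
  case: ifPn => //; rewrite /g patchE; case: ifPn => // /set_mem t01.
  by rewrite mem_set//=; exact: subset_itv_oo_cc t01.
have ig : lebesgue_measure.-integrable [set: R] g.
  apply/integrableP; split=> //.
  under eq_integral do rewrite gee0_abs//.
  by rewrite gT (le_lt_trans gJ).
have mG : measurable_fun [set: R] (EFin \o G).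
  by apply/measurable_EFinP; apply: measurableT_comp => //; exact: fine_measurable.
have iG : lebesgue_measure.-integrable [set: R] (EFin \o G).
  apply: le_integrable ig => // t _.
  by rewrite [leLHS]gee0_abs ?lee_fin// gee0_abs//; exact: Gg.
have iGD (D : set R) : measurable D -> lebesgue_measure.-integrable D (EFin \o G).
  by move=> mD; apply: integrableS iG.
pose I (y : R) := (\int[lebesgue_measure]_(t in [set` Interval (BLeft (0:R)) (BRight y)]) G t)%R.
have lG : locally_integrable [set: R] G.
  by have := integrable_locally measurableT iG; rewrite patch_setT.
have dI := @FTC1 R G (BLeft 0) (fun y => iGD _ (measurable_itv _)) lG.
have fg := integrable_ae measurableT ig.
have IE y : (I y)%:E = (\int[lebesgue_measure]_(t in `[0%R, y]) (G t)%:E)%E.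
  by rewrite /I /Rintegral fineK//; apply: integrable_fin_num => //; exact: iGD.
have Imono (s t : R) : 0 <= s -> s <= t -> t <= 1 -> I s <= I t.
  move=> s0 st t1; rewrite -lee_fin !IE; apply: ge0_subset_integral => //.
  - exact: measurable_funTS.
  - by move=> x _; rewrite lee_fin.
  - by move=> x /=; rewrite !in_itv/= => /andP[-> /le_trans]; exact.
have I0 : 0 <= I 0 by apply: Rintegral_ge0.
have I1 : ((I 1)%:E <= J)%E.
  rewrite IE; apply: le_trans gJ; apply: ge0_le_integral => //.
  - by move=> x _; rewrite lee_fin.
  - exact: measurable_funTS.
  - exact: measurable_funTS.
apply: le_trans I1; rewrite lee_fin.
suff : K 1 - K 0 <= I 1 - I 0 by lra.
(* The exceptional points: [g] is infinite, or [I] does not have derivative [G], or [t] is the end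
   1, where [g] was cut off. *)
pose N : set R := ~` [set t : R | (setT t -> g t \is a fin_num) /\
  ((BLeft 0%R < BRight t)%E -> derivable I t 1 /\ derive1 I t = G t)] `|` [set 1].
apply: (@abs_continuous_increment_le _ K I N acK Imono).
  apply: negligibleU; last by exists [set 1]; split=> //; exact: lebesgue_measure_set1.
  have H := @filterI _ _ (ae_filter_ringOfSetsType _) _ _ fg dI.
  have [A [mA A0 HA]] := H; exists A; split; [exact: mA|exact: A0|].
  move=> x Hx; apply: HA; move=> [h1 h2]; apply: Hx.
  by split; [exact: h1|exact: h2].
move=> t /andP[t0 t1] /not_orP[/contrapT[gt dIt] /eqP t_neq1] e e0.
have {}t1 : t < 1 by rewrite lt_neqAle t_neq1.
have t01 : t \in `]0 : R, 1 : R[ by rewrite in_itv/= t0.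
have {dIt}[dIt dIE] := dIt t0.
have idI : is_derive t 1 I (G t) by apply: (DeriveDef dIt); rewrite -derive1E; exact: dIE.
have e2 : 0 < e / 2 by rewrite divr_gt0.
have qG : (limn_esup (q^~ t) < (G t + e / 2)%:E)%E.
  apply: (@le_lt_trans _ _ (G t)%:E); last by rewrite lte_fin ltrDl.
  rewrite /G/= fineK ?gt// /g patchE mem_set//.
  by rewrite /w le_max lexx.
have [k [[kt qk] Ik]] := filter_ex (filterI (filterI (near0 t t01)
  (limn_esup_lt_near qG)) (is_derive_left_seq idI e2)).
have k0 : 0 < k.+1%:R^-1 :> R by rewrite invr_gt0.
exists (t - k.+1%:R^-1); split; first by rewrite subr_ge0 ltW.
  by rewrite ltrBlDr ltrDl.
move: qk; rewrite /q lte_fin K'E// -ltr_pdivlMr// => qk.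
move: Ik; rewrite ler_norml => /andP[Ik _].
have -> : t - (t - k.+1%:R^-1) = k.+1%:R^-1 by ring.
move: Ik qk; move: (I t) (I (t - k.+1%:R^-1)) (K t) (K (t - k.+1%:R^-1)) (G t).
by move: (k.+1%:R^-1) => *; lra.
Qed.

(** * Inner products and the length of a geodesic *)

Lemma sqnorm_ge0 (R : realType) (n : nat) (x : 'rV[R]_n) : 0 <= sqnorm x.
Proof. by apply: sumr_ge0 => j _; rewrite -expr2 sqr_ge0. Qed.

Lemma sqnorm_eq0 (R : realType) (n : nat) (x : 'rV[R]_n) : sqnorm x = 0 -> x = 0.
Proof.
move=> /eqP; rewrite psumr_eq0; last by move=> j _; rewrite -expr2 sqr_ge0.
move=> /allP H; apply/rowP => j; rewrite mxE.
have := H j; rewrite mem_index_enum -expr2 sqrf_eq0 => /(_ isT)/eqP; exact.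
Qed.

Lemma sqnorm_lin (R : realType) (n : nat) (k l : R) (x y : 'rV[R]_n) :
  sqnorm (k *: x + l *: y) =
  k ^+ 2 * sqnorm x + 2 * (k * l) * dot x y + l ^+ 2 * sqnorm y.
Proof.
rewrite /sqnorm /dot !mulr_sumr -!big_split/=; apply: eq_bigr => j _.
by rewrite !mxE; ring.
Qed.

Lemma dot_linl (R : realType) (n : nat) (k l : R) (x y z : 'rV[R]_n) :
  dot (k *: x + l *: y) z = k * dot x z + l * dot y z.
Proof.
rewrite /dot !mulr_sumr -big_split/=; apply: eq_bigr => j _; rewrite !mxE; ring.
Qed.

Lemma dotC (R : realType) (n : nat) (x y : 'rV[R]_n) : dot x y = dot y x.
Proof. by apply: eq_bigr => j _; rewrite mulrC. Qed.

Lemma dotZr (R : realType) (n : nat) (k : R) (x y : 'rV[R]_n) :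
  dot x (k *: y) = k * dot x y.
Proof. by rewrite /dot mulr_sumr; apply: eq_bigr => j _; rewrite mxE; ring. Qed.

(* A control is optimal at [p] as soon as its [beta] is proportional to [p.1]. *)
Lemma CCnorm_hcomb (R : realType) (n : nat) (p : 'rV[R]_n * R)
    (alpha : 'rV[R]_n) (b : R) :
  CCnorm p (hcomb p alpha (b *: p.1)) =
  (Num.sqrt (sqnorm alpha + b ^+ 2 * sqnorm p.1))%:E.
Proof.
have bE : sqnorm (b *: p.1) = b ^+ 2 * sqnorm p.1.
  by have := sqnorm_lin b 0 p.1 0; rewrite scaler0 addr0 => ->; ring.
rewrite /CCnorm (_ : sqCCnorm p _ = (sqnorm alpha + b ^+ 2 * sqnorm p.1)%:E)//.
apply/eqP; rewrite eq_le; apply/andP; split.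
  by apply: ereal_inf_lbound; exists (alpha, b *: p.1) => //=; rewrite bE.
apply: le_ereal_inf_tmp => _ [[a' b'] /= + <-]; rewrite !hcombE => -[<- E].
rewrite lee_fin lerD2l.
have := sqnorm_ge0 (1 *: b' + (- b) *: p.1); rewrite sqnorm_lin -E.
rewrite (_ : dot (b *: p.1) p.1 = b * sqnorm p.1); last first.
  by rewrite dotC dotZr.
lra.
Qed.

(** The endpoints form a null set; a curve restricted to [0, 1] may fail to be differentiable
    there. *)
Lemma CClength_const (R : realType) (n : nat) (g : R -> 'rV[R]_n * R) (r : R) :
  (forall t : R, t \in `]0 : R, 1 : R[ -> CCnorm (g t) (derive1 g t) = r%:E) ->
  CClength g = r%:E.
Proof.
move=> H; rewrite /CClength.
have H' : {in (`]0 : R, 1 : R[%classic : set R), cst r%:E =1 fun t => CCnorm (g t) (derive1 g t)}.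
  by move=> t /set_mem /= t01; rewrite H.
rewrite integral_itv_bndoo; last exact: (eq_measurable_fun _ H').
rewrite (eq_integral (cst r%:E)); last by move=> t /H' <-.
rewrite integral_cst//= [X in (_ * X)%E](lebesgue_measure_itv `]0 : R, 1 : R[)/= lte_fin ltr01.
by rewrite sube0 mule1.
Qed.

(** Conservation of energy: [galpha] and [b *: x] are the controls of the geodesic. *)
Lemma gcurve_speed (R : realType) (n : nat) (x1 c : 'rV[R]_n) (b t : R) :
  sqnorm (galpha x1 b c t) + b ^+ 2 * sqnorm (gcurve x1 b c t).1 =
  sqnorm c + b ^+ 2 * sqnorm x1.
Proof.
rewrite /galpha /gcurve -scaleNr sqnorm_lin; case: eqP => [->|/eqP b0] /=.
  by rewrite mul0r cos0; ring.
rewrite sqnorm_lin (dotC c x1).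
have := cos2Dsin2 (b * t); move: (cos _) (sin _) => C s E.
have E1 : C ^+ 2 = 1 - s ^+ 2 by rewrite -E; ring.
by field: E1.
Qed.

Lemma CClength_gcurve_eq (R : realType) (n : nat) (x1 c : 'rV[R]_n) (b : R)
    (g : R -> 'rV[R]_n * R) :
  (forall t : R, t \in `]0 : R, 1 : R[ -> g t = gcurve x1 b c t) ->
  CClength g = (Num.sqrt (sqnorm c + b ^+ 2 * sqnorm x1))%:E.
Proof.
move=> gE; apply: CClength_const => t t01.
have [D _] := is_derive_gcurve x1 b c t.
have D' : is_derive t 1 g (hcomb (g t) (galpha x1 b c t) (b *: (g t).1)).
  rewrite gE//; apply: near_eq_is_derive D.
  by near=> s; rewrite gE//; near: s; exact: near_in_itvoo.
rewrite derive1E (@derive_val _ _ _ _ _ _ _ D') CCnorm_hcomb gE//.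
by rewrite gcurve_speed.
Unshelve. all: by end_near. Qed.

(** * Geodesics are Lipschitz, hence horizontal *)

Definition lipschitz01 (R : realType) (V : normedModType R) (g : R -> V) : Prop :=
  exists C : R, forall s t : R, 0 <= s -> s <= t -> t <= 1 -> `|g t - g s| <= C * (t - s).

Lemma lipschitz01D (R : realType) (V : normedModType R) (f g : R -> V) :
  lipschitz01 f -> lipschitz01 g -> lipschitz01 (fun t => f t + g t).
Proof.
move=> [C HC] [D HD]; exists (C + D) => s t s0 st t1.
by rewrite opprD addrACA mulrDl (le_trans (ler_normD _ _))// lerD ?HC ?HD.
Qed.

Lemma lipschitz01Z (R : realType) (V : normedModType R) (f : R -> R) (v : V) :
  lipschitz01 (f : R -> R^o) -> lipschitz01 (fun t => f t *: v).
Proof.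
move=> [C HC]; exists (C * `|v|) => s t s0 st t1.
by rewrite -scalerBl normrZ mulrAC ler_wpM2r// HC.
Qed.

Lemma lipschitz01M (R : realType) (f : R -> R) (k : R) :
  lipschitz01 (f : R -> R^o) -> lipschitz01 ((fun t => k * f t) : R -> R^o).
Proof.
move=> [C HC]; exists (`|k| * C) => s t s0 st t1.
by rewrite -mulrBr normrM -mulrA ler_wpM2l// HC.
Qed.

Lemma lipschitz01_pair (R : realType) (V W : normedModType R) (f : R -> V) (g : R -> W) :
  lipschitz01 f -> lipschitz01 g -> lipschitz01 (fun t => (f t, g t)).
Proof.
move=> [C HC] [D HD]; exists (`|C| + `|D|) => s t s0 st t1.
have ts : 0 <= t - s by rewrite subr_ge0.
rewrite prod_normE ge_max /=; apply/andP; split.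
  apply: le_trans (HC s t s0 st t1) _; rewrite ler_wpM2r//.
  by rewrite (le_trans (ler_norm C))// lerDl.
apply: le_trans (HD s t s0 st t1) _; rewrite ler_wpM2r//.
by rewrite (le_trans (ler_norm D))// lerDr.
Qed.

Lemma lipschitz01_derive (R : realType) (f f' : R -> R) (C : R) :
  (forall t : R, is_derive t 1 f (f' t)) -> (forall t, `|f' t| <= C) ->
  lipschitz01 (f : R -> R^o).
Proof.
move=> df fC; exists C => s t s0 st t1.
have cf : {within `[s, t], continuous f}.
  by apply: derivable_within_continuous => x _; case: (df x).
have [c _ ->] := MVT_segment st (fun x _ => df x) cf.
by rewrite normrM [X in _ * X]ger0_norm ?subr_ge0// ler_wpM2r ?subr_ge0.
Qed.

Lemma lipschitz01_sin (R : realType) (b : R) : lipschitz01 ((fun t => sin (b * t)) : R -> R^o).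
Proof.
apply: (lipschitz01_derive (is_derive_linsin b) (C := `|b|)) => t.
by rewrite normrM ler_piMr// cos_max.
Qed.

Lemma lipschitz01_cos (R : realType) (b : R) : lipschitz01 ((fun t => cos (b * t)) : R -> R^o).
Proof.
apply: (lipschitz01_derive (is_derive_lincos b) (C := `|b|)) => t.
by rewrite normrN normrM ler_piMr// sin_max.
Qed.

Lemma lipschitz01_id (R : realType) : lipschitz01 (id : R -> R^o).
Proof. by exists 1 => s t s0 st t1; rewrite mul1r ger0_norm ?subr_ge0. Qed.

Lemma lipschitz01_cst (R : realType) (V : normedModType R) (v : V) :
  lipschitz01 (fun _ : R => v).
Proof. by exists 0 => s t _ _ _; rewrite subrr normr0 mul0r. Qed.

Lemma lipschitz01_gcurve (R : realType) (n : nat) (x1 c : 'rV[R]_n) (b : R) :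
  lipschitz01 (gcurve x1 b c).
Proof.
rewrite /gcurve; case: eqP => [_|/eqP b0].
  apply: lipschitz01_pair; last exact: lipschitz01_cst.
  apply: lipschitz01D; last exact: lipschitz01_cst.
  exact/lipschitz01Z/lipschitz01_id.
apply: lipschitz01_pair.
  apply: lipschitz01D; apply: lipschitz01Z; last exact: lipschitz01_cos.
  rewrite (_ : (fun t => _) = (fun t => b^-1 * sin (b * t))); last first.
    by apply/funext => t; rewrite mulrC.
  exact/lipschitz01M/lipschitz01_sin.
(* The double angle formula for [sin (b * t) ^+ 2] leaves only linear, sine, cosine and constant
   terms. *)
rewrite (_ : (fun t => _) = (fun t => (sqnorm c / b / 2 + sqnorm x1 * b / 2) * t +
  (- (sqnorm c / b / (4 * b)) + sqnorm x1 / 4) * sin ((2 * b) * t) +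
  (- (dot x1 c / b / 2)) * cos ((2 * b) * t) + dot x1 c / b / 2)); last first.
  apply/funext => t.
  have -> : cos (2 * b * t) = 1 - 2 * sin (b * t) ^+ 2.
    by rewrite -mulrA mulr_natl cos_mulr2n cos2sin2; ring.
  by field.
apply: lipschitz01D; last exact: lipschitz01_cst.
apply: lipschitz01D; last exact/lipschitz01M/lipschitz01_cos.
apply: lipschitz01D; last exact/lipschitz01M/lipschitz01_sin.
exact/lipschitz01M/lipschitz01_id.
Qed.

Lemma lipschitz01_abs_continuous (R : realType) (n : nat) (g : R -> 'rV[R]_n * R) :
  lipschitz01 g -> abs_continuous01 g.
Proof.
move=> [C HC] e e0; pose D := `|C| + 1.
have D0 : 0 < D by rewrite ltr_wpDl.
exists (e / D); first exact: divr_gt0.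
move=> m s t st _; rewrite ltr_pdivlMr// mulrC; apply: le_lt_trans.
rewrite mulr_sumr; apply: ler_sum => i _; have [s0 sti t1] := st i.
apply: le_trans (HC _ _ s0 sti t1) _; rewrite ler_wpM2r ?subr_ge0//.
by rewrite (le_trans (ler_norm C))// /D lerDl.
Qed.

Lemma horizontal_gcurve (R : realType) (n : nat) (x1 c : 'rV[R]_n) (b : R) :
  horizontal (gcurve x1 b c).
Proof.
split; first exact/lipschitz01_abs_continuous/lipschitz01_gcurve.
apply: aeW => t _; have [[D E] _] := is_derive_gcurve x1 b c t.
split=> //; exists (galpha x1 b c t), (b *: (gcurve x1 b c t).1).
by rewrite derive1E.
Qed.

(** * The action with a fixed multiplier *)

(** Writing b / sin b as [(sinc b)^-1] makes [action] continuous in the multiplier down to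
    [b = 0]. *)
Definition sinc (R : realType) (b : R) : R := if b == 0 then 1 else sin b / b.

Lemma sinc_gt0 (R : realType) (b : R) : 0 <= b < pi -> 0 < sinc b.
Proof.
move=> /andP[b0 bpi]; rewrite /sinc; case: eqP => // /eqP b_neq0.
have {}b0 : 0 < b by rewrite lt_neqAle eq_sym b_neq0.
by rewrite divr_gt0// sin_gt0_pi// b0.
Qed.

Lemma near_neq0 (R : realType) (b : R) : b != 0 -> \forall t \near b, t != 0.
Proof.
move=> b0; apply: (@open_nbhs_nbhs _ b [set t | t != 0]).
by split => //; exact: open_neq.
Qed.

Lemma continuous_sinc (R : realType) : continuous (@sinc R).
Proof.
move=> b; have [->|b0] := eqVneq b 0.
  (* At [0] the limit is the derivative of sine, [cos 0 = 1]. *)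
  apply/continuous_withinNx; rewrite {2}/sinc eqxx -[X in _ --> X](@cos0 R).
  have [D <-] := is_derive_sin (0 : R).
  apply: cvg_trans D; apply: near_eq_cvg; near=> h.
  have h0 : h != 0 by near: h; exact: nbhs_dnbhs_neq.
  by rewrite /= sin0 subr0 addr0 scaler1 /sinc (negbTE h0) /GRing.scale/= mulrC.
have cb : {for b, continuous (fun t : R => sin t / t)}.
  by apply: continuousM; [exact: continuous_sin | exact: inv_continuous].
rewrite /continuous_at {2}/sinc (negbTE b0); apply: cvg_trans cb.
apply: near_eq_cvg; near=> t.
have t0 : t != 0 by near: t; exact: near_neq0.
by rewrite /sinc (negbTE t0).
Unshelve. all: by end_near. Qed.

(* The least energy needed to go in unit time from [x1] to [p.1], when the
   vertical displacement is charged at the multiplier rate [2 * b]. *)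
Definition action (R : realType) (n : nat) (x1 : 'rV[R]_n) (b : R) (p : 'rV[R]_n * R) : R :=
  2 * b * p.2 + cos b * (sinc b)^-1 * (sqnorm x1 + sqnorm p.1) -
  2 * (sinc b)^-1 * dot x1 p.1.

(** Half the derivatives of [action] along the fields X_j; those along the U_j are halved to
    [b *: x]. *)
Definition action_grad (R : realType) (n : nat) (x1 : 'rV[R]_n) (b : R) (x : 'rV[R]_n) :
  'rV[R]_n := (cos b * (sinc b)^-1) *: x + (- (sinc b)^-1) *: x1.

Lemma action_gradE (R : realType) (n : nat) (x1 x : 'rV[R]_n) (b : R) : 0 <= b < pi ->
  sqnorm (action_grad x1 b x) + b ^+ 2 * sqnorm x =
  (sinc b)^-1 ^+ 2 * (sqnorm x1 + sqnorm x) -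
  2 * (cos b * (sinc b)^-1) * (sinc b)^-1 * dot x1 x.
Proof.
move=> b_itv; rewrite /action_grad sqnorm_lin (dotC x x1).
have S : b = sin b * (sinc b)^-1.
  have := sinc_gt0 b_itv; rewrite /sinc; case: eqP => [->|/eqP b0 s0].
    by rewrite sin0 mul0r.
  have {}s0 : sin b != 0 by apply: contraTneq s0 => ->; rewrite mul0r ltxx.
  by rewrite invf_div; field; rewrite s0.
have -> : b ^+ 2 = (1 - cos b ^+ 2) * (sinc b)^-1 ^+ 2.
  by rewrite -sin2cos2 -exprMn -S.
ring.
Qed.

Lemma continuous_action (R : realType) (n : nat) (x1 : 'rV[R]_n) (p : 'rV[R]_n * R) (b : R) :
  0 <= b < pi -> {for b, continuous (fun b => action x1 b p)}.
Proof.
move=> b_itv.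
have cS : {for b, continuous (fun b : R => (sinc b)^-1)}.
  by apply: continuousV; [rewrite gt_eqF// sinc_gt0|exact: continuous_sinc].
apply: continuousB; last first.
  by apply: continuousM; [apply: continuousM => //; exact: cst_continuous|exact: cst_continuous].
apply: continuousD.
  apply: continuousM; last exact: cst_continuous.
  by apply: continuousM => //; exact: cst_continuous.
apply: continuousM; last exact: cst_continuous.
by apply: continuousM => //; exact: continuous_cos.
Qed.

Lemma is_derive_action (R : realType) (n : nat) (x1 : 'rV[R]_n) (p : 'rV[R]_n * R) (b : R) :
  0 < b < pi -> is_derive b 1 (fun b => action x1 b p)
    (2 * p.2 + (cot b - b / sin b ^+ 2) * (sqnorm x1 + sqnorm p.1)
     - 2 * ((sin b)^-1 - b * cos b / sin b ^+ 2) * dot x1 p.1).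
Proof.
move=> b_itv; have /andP[b0 _] := b_itv.
have s0 : sin b != 0 by rewrite gt_eqF// sin_gt0_pi.
set N := sqnorm x1 + sqnorm p.1; set M := dot x1 p.1.
have dV : is_derive b 1 (fun y : R => (sin y)^-1) (- (sin b) ^- 2 * cos b).
  exact: is_deriveV.
have D : is_derive b 1 (fun y : R => (2 * p.2) * y + N * (y * (cos y * (sin y)^-1)) -
    (2 * M) * (y * (sin y)^-1))
    (2 * p.2 + (cot b - b / sin b ^+ 2) * N - 2 * ((sin b)^-1 - b * cos b / sin b ^+ 2) * M).
  apply: is_derive_eq; rewrite /= /GRing.scale /= /cot.
  have := cos2Dsin2 b; move: (cos b) (sin b) s0 => C s s0 E.
  have E1 : C ^+ 2 = 1 - s ^+ 2 by rewrite -E; ring.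
  by field: E1.
apply: near_eq_is_derive D; near=> y.
have y0 : y != 0 by near: y; apply: near_neq0; rewrite gt_eqF.
by rewrite /action /sinc (negbTE y0) invf_div -/N -/M; ring.
Unshelve. all: by end_near. Qed.

(* At a maximiser of the action over the multipliers [0, bs] the
   Hamilton-Jacobi equation [|grad|^2 = action - b * (d action / d b)] gives
   [|grad|^2 <= action]. *)
Lemma action_grad_le (R : realType) (n : nat) (x1 : 'rV[R]_n) (p : 'rV[R]_n * R)
    (b bs : R) : bs < pi -> 0 <= b <= bs ->
  (forall b', 0 <= b' <= bs -> action x1 b' p <= action x1 b p) ->
  sqnorm (action_grad x1 b p.1) + b ^+ 2 * sqnorm p.1 <= action x1 b p.
Proof.
move=> bspi /andP[b0 bbs] H; rewrite action_gradE; last by rewrite b0 (le_lt_trans bbs).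
move: b0; rewrite le_eqVlt => /predU1P[<-|b0].
  by rewrite /action /sinc eqxx cos0 invr1; lra.
have b_itv : 0 < b < pi by rewrite b0 (le_lt_trans bbs).
have s0 : sin b != 0 by rewrite gt_eqF// sin_gt0_pi.
have := is_derive_action x1 p b_itv; set d := (X in is_derive _ _ _ X) => D.
(* Comparison with left neighbours of [b] only, which stay admissible even when [b = bs]. *)
have d0 : 0 <= d.
  rewrite -oppr_le0; apply/ler_addgt0Pr => e e0.
  have [k [kb]] := filter_ex (filterI (near_infty_natSinv_lt (PosNum b0))
    (is_derive_left_seq D e0)).
  have k0 : 0 < k.+1%:R^-1 :> R by rewrite invr_gt0.
  have {}kb : k.+1%:R^-1 < b := kb; rewrite ler_norml /= => /andP[_ Hk].
  have Hb : action x1 (b - k.+1%:R^-1) p <= action x1 b p.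
    apply: H; move: kb k0 bbs; clear; move: (k.+1%:R^-1) => *; apply/andP; split; lra.
  rewrite add0r -(ler_pM2r k0); move: Hk Hb; clear.
  by move: d (k.+1%:R^-1) (action _ _ _) (action _ _ _) => *; lra.
rewrite -subr_ge0.
rewrite (_ : _ - _ = b * d) ?mulr_ge0 ?(ltW b0)//.
rewrite /d /action /sinc (gt_eqF b0) invf_div /cot.
by field; rewrite s0.
Qed.

Definition max_action_at (R : realType) (n : nat) (x1 : 'rV[R]_n) (bs : R)
    (p : 'rV[R]_n * R) (b : R) : Prop :=
  0 <= b <= bs /\ forall b', 0 <= b' <= bs -> action x1 b' p <= action x1 b p.

Lemma max_action_exists (R : realType) (n : nat) (x1 : 'rV[R]_n) (bs : R) :
  0 <= bs < pi -> exists bm : 'rV[R]_n * R -> R, forall p, max_action_at x1 bs p (bm p).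
Proof.
move=> /andP[bs0 bspi]; suff H p : exists b, max_action_at x1 bs p b.
  by have [bm Hbm] := choice H; exists bm.
have C : {within `[0, bs], continuous (fun b => action x1 b p)}.
  apply: continuous_in_subspaceT => b /set_mem /=; rewrite in_itv/= => /andP[b0 bb].
  by apply: continuous_action; rewrite b0 (le_lt_trans bb).
have [b + Hb] := EVT_max bs0 C; rewrite in_itv/= => b_itv.
by exists b; split=> // b' b'_itv; apply: Hb; rewrite in_itv.
Qed.

Lemma sinc_bound (R : realType) (bs : R) : 0 <= bs < pi ->
  exists2 M : R, 0 <= M & forall b, 0 <= b <= bs -> (sinc b)^-1 <= M.
Proof.
move=> /andP[bs0 bspi].
have C : {within `[0, bs], continuous (fun b : R => (sinc b)^-1)}.
  apply: continuous_in_subspaceT => b /set_mem /=; rewrite in_itv/= => /andP[b0 bb].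
  apply: continuousV; last exact: continuous_sinc.
  by rewrite gt_eqF// sinc_gt0// b0 (le_lt_trans bb).
have [b b_itv Hb] := EVT_max bs0 C; exists (sinc b)^-1.
  move: b_itv; rewrite in_itv/= => /andP[b0 bb].
  by rewrite invr_ge0 ltW// sinc_gt0// b0 (le_lt_trans bb).
by move=> b' b'_itv; apply: Hb; rewrite in_itv.
Qed.

Lemma coord_le_norm (R : realType) (n : nat) (x : 'rV[R]_n) (j : 'I_n) : `|x 0 j| <= `|x|.
Proof.
rewrite /Num.norm/= mx_normrE.
have := @le_bigmax _ R _ 0 (fun ij : 'I_1 * 'I_n => `|x ij.1 ij.2|) (0, j); exact.
Qed.

(** The norm of a row vector is the maximum norm, whence the factor [n]. *)
Lemma dot_le_norm (R : realType) (n : nat) (x y : 'rV[R]_n) :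
  `|dot x y| <= n%:R * `|x| * `|y|.
Proof.
apply: le_trans (ler_norm_sum _ _ _) _.
apply: (@le_trans _ _ (\sum_(j < n) `|x| * `|y|)).
  by apply: ler_sum => j _; rewrite normrM ler_pM// coord_le_norm.
by rewrite sumr_const card_ord -mulrA mulr_natl.
Qed.

(** The constant is uniform in the multiplier, so the maximum over multipliers inherits it. Its
    three summands bound the three terms of [action]. *)
Lemma action_lipschitz (R : realType) (n : nat) (x1 : 'rV[R]_n) (bs r : R) :
  0 <= bs < pi -> 0 <= r -> exists2 L : R, 0 <= L &
  forall b (p q : 'rV[R]_n * R), 0 <= b <= bs -> `|p| <= r -> `|q| <= r ->
    action x1 b p - action x1 b q <= L * `|p - q|.
Proof.
move=> bs_itv r0; have [M M0 HM] := sinc_bound bs_itv.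
have /andP[bs0 bspi] := bs_itv.
exists (2 * bs + M * (2 * n%:R * r) + 2 * M * (n%:R * `|x1|)).
  by rewrite !addr_ge0// !mulr_ge0.
move=> b p q b_itv pr qr; have /andP[b0 bb] := b_itv.
have S0 : 0 < (sinc b)^-1 by rewrite invr_gt0 sinc_gt0// b0 (le_lt_trans bb).
have SM := HM b b_itv.
set d := `|p - q|; have d0 : 0 <= d by exact: normr_ge0.
have fst_le (z : 'rV[R]_n * R) : `|z.1| <= `|z| by rewrite prod_normE le_max lexx.
have snd_le (z : 'rV[R]_n * R) : `|z.2| <= `|z| by rewrite prod_normE le_max lexx orbT.
have h1 : `|p.2 - q.2| <= d by exact: (snd_le (p - q)).
have h2 : `|p.1 - q.1| <= d by exact: (fst_le (p - q)).
have E1 : sqnorm p.1 - sqnorm q.1 = dot (p.1 + q.1) (p.1 - q.1).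
  rewrite /sqnorm /dot -sumrB; apply: eq_bigr => j _; rewrite !mxE; ring.
have E2 : dot x1 p.1 - dot x1 q.1 = dot x1 (p.1 - q.1).
  rewrite /dot -sumrB; apply: eq_bigr => j _; rewrite !mxE; ring.
have k1 : `|sqnorm p.1 - sqnorm q.1| <= 2 * n%:R * r * d.
  rewrite E1; apply: le_trans (dot_le_norm _ _) _.
  apply: (@le_trans _ _ (n%:R * (2 * r) * d)); last first.
    by rewrite le_eqVlt; apply/orP; left; apply/eqP; ring.
  rewrite ler_pM ?mulr_ge0// ler_wpM2l//.
  apply: le_trans (ler_normD _ _) _; have := fst_le p; have := fst_le q; lra.
have k2 : `|dot x1 p.1 - dot x1 q.1| <= n%:R * `|x1| * d.
  rewrite E2; apply: le_trans (dot_le_norm _ _) _.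
  by rewrite ler_wpM2l ?mulr_ge0.
have -> : action x1 b p - action x1 b q = 2 * b * (p.2 - q.2) +
   cos b * (sinc b)^-1 * (sqnorm p.1 - sqnorm q.1) -
   2 * (sinc b)^-1 * (dot x1 p.1 - dot x1 q.1) by rewrite /action; ring.
have cS : `|cos b * (sinc b)^-1| <= M.
  rewrite normrM [X in _ * X]gtr0_norm//; apply: le_trans SM.
  by rewrite ler_piMl ?(ltW S0)// cos_max.
have t1 : 2 * b * (p.2 - q.2) <= 2 * bs * d.
  apply: le_trans (ler_norm _) _; rewrite normrM; apply: ler_pM => //.
  by rewrite ger0_norm ?mulr_ge0// ler_pM2l.
have t2 : cos b * (sinc b)^-1 * (sqnorm p.1 - sqnorm q.1) <= M * (2 * n%:R * r * d).
  by apply: le_trans (ler_norm _) _; rewrite normrM; apply: ler_pM.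
have t3 : - (2 * (sinc b)^-1 * (dot x1 p.1 - dot x1 q.1)) <= 2 * M * (n%:R * `|x1| * d).
  apply: le_trans (ler_norm _) _; rewrite normrN normrM; apply: ler_pM => //.
  by rewrite ger0_norm ?mulr_ge0 ?(ltW S0)// ler_pM2l.
by move: t1 t2 t3; clear; lra.
Qed.

(** * The lower bound on the length of horizontal curves *)

(** Cauchy-Schwarz for pairs of controls, from the squared norm of [M] (a, b) - [P] (c, d); if
    [M = 0] then [c] and [d] vanish. *)
Lemma dot2_sqr_le (R : realType) (n : nat) (a b c d : 'rV[R]_n) :
  (dot a c + dot b d) ^+ 2 <= (sqnorm a + sqnorm b) * (sqnorm c + sqnorm d).
Proof.
set P := _ + dot b d; set N := sqnorm a + _; set M := sqnorm c + _.
have M0 : 0 <= M by rewrite addr_ge0 ?sqnorm_ge0.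
have : 0 <= sqnorm (M *: a + (- P) *: c) + sqnorm (M *: b + (- P) *: d).
  by rewrite addr_ge0 ?sqnorm_ge0.
rewrite !sqnorm_lin.
rewrite [X in _ <= X](_ : _ = M * (N * M - P ^+ 2)); last by rewrite /M /N /P; ring.
move: M0; rewrite le_eqVlt => /predU1P[M0 _|M0]; last by rewrite pmulr_rge0// subr_ge0.
have c0 : sqnorm c = 0 by have := sqnorm_ge0 c; have := sqnorm_ge0 d; rewrite /M in M0; lra.
have d0 : sqnorm d = 0 by have := sqnorm_ge0 c; have := sqnorm_ge0 d; rewrite /M in M0; lra.
rewrite -M0 mulr0 /P (sqnorm_eq0 c0) (sqnorm_eq0 d0).
have z (v : 'rV[R]_n) : dot v 0 = 0 by rewrite -(scaler0 _ (0 : R)) dotZr mul0r.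
by rewrite !z addr0 expr0n.
Qed.

Lemma is_derive_dot (R : realType) (n : nat) (y z : R -> 'rV[R]_n) (y' z' : 'rV[R]_n) (t : R) :
  (forall j, is_derive t 1 (fun s => y s 0 j) (y' 0 j)) ->
  (forall j, is_derive t 1 (fun s => z s 0 j) (z' 0 j)) ->
  is_derive t 1 (fun s => dot (y s) (z s)) (dot y' (z t) + dot (y t) z').
Proof.
move=> dy dz.
have D j : is_derive t 1 (fun s => y s 0 j * z s 0 j) (y' 0 j * z t 0 j + y t 0 j * z' 0 j).
  have Dy := dy j; have Dz := dz j.
  by apply: is_derive_eq; rewrite /= /GRing.scale/=; ring.
rewrite (_ : (fun s => _) = \sum_(j < n) (fun s => y s 0 j * z s 0 j)); last first.
  by apply/funext => s; rewrite fct_sumE.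
rewrite (_ : _ + _ = \sum_(j < n) (y' 0 j * z t 0 j + y t 0 j * z' 0 j)); last first.
  by rewrite /dot -big_split.
exact: is_derive_sum.
Qed.

Lemma is_derive_action_along (R : realType) (n : nat) (x1 : 'rV[R]_n) (b t : R)
    (g : R -> 'rV[R]_n * R) (al be : 'rV[R]_n) :
  is_derive t 1 g (hcomb (g t) al be) ->
  is_derive t 1 (fun s => action x1 b (g s))
    (2 * (dot al (action_grad x1 b (g t).1) + dot be (b *: (g t).1))).
Proof.
rewrite hcombE => /is_derive_coord[D1 D2].
have Ds : is_derive t 1 (fun s => sqnorm (g s).1) (dot al (g t).1 + dot (g t).1 al).
  exact: is_derive_dot.
have Dx : is_derive t 1 (fun s => dot x1 (g s).1) (dot 0 (g t).1 + dot x1 al).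
  apply: (is_derive_dot (y := fun=> x1)) => // j; rewrite mxE; exact: is_derive_cst.
rewrite /action; apply: is_derive_eq; rewrite /= /GRing.scale/=.
have -> : dot 0 (g t).1 = 0.
  by have := dot_linl 0 0 0 0 (g t).1; rewrite !scaler0 addr0 !mul0r addr0.
rewrite (dotC al (action_grad _ _ _)) /action_grad dot_linl dotZr (dotC (g t).1 al).
ring.
Qed.

Lemma seq_abs_continuous_bounded (R : realType) (V : normedModType R) (g : R -> V) :
  seq_abs_continuous g -> exists2 r : R, 0 <= r & forall t, 0 <= t <= 1 -> `|g t| <= r.
Proof.
move=> ag; pose N (t : R) := `|g t|.
have aN : seq_abs_continuous (N : R -> R^o).
  apply: (@lipschitz_seq_abs_continuous _ _ _ g _ 1) ag => s t _ _ _.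
  by rewrite mul1r ler_dist_dist.
have C : {within `[0 : R, 1 : R], continuous (N \o @clamp01 R)}.
  by apply: continuous_subspaceT; exact: seq_abs_continuous_clamp.
have [c _ Hc] := EVT_max ler01 C; exists (N (clamp01 c)) => [|t t01].
  exact: normr_ge0.
by have := Hc t; rewrite in_itv/= t01 /= (clamp01_id t01) => /(_ isT).
Qed.

(** The shift by [e ^+ 2] keeps both roots at least [e], away from the point where the square root
    is not Lipschitz. *)
Lemma sqrt_lipschitz (R : realType) (e x y : R) : 0 < e -> 0 <= x -> 0 <= y ->
  `|Num.sqrt (e ^+ 2 + x) - Num.sqrt (e ^+ 2 + y)| <= e^-1 * `|x - y|.
Proof.
move=> e0 x0 y0.
have ge_e (z : R) : 0 <= z -> e <= Num.sqrt (e ^+ 2 + z).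
  by move=> z0; rewrite -{1}(gtr0_norm e0) -sqrtr_sqr ler_wsqrtr// lerDl.
set a := Num.sqrt _; set b := Num.sqrt _.
have ea : e <= a by exact: ge_e.
have eb : e <= b by exact: ge_e.
have -> : x - y = (a - b) * (a + b).
  rewrite -subr_sqr !sqr_sqrtr ?addr_ge0 ?sqr_ge0//; ring.
rewrite normrM mulrCA ler_peMr// (@gtr0_norm _ (a + b)); last by lra.
by rewrite mulrC ler_pdivlMr// mul1r; lra.
Qed.

Lemma CCnorm_lt_ex (R : realType) (n : nat) (p v : 'rV[R]_n * R) (y : R) :
  (CCnorm p v < y%:E)%E -> 0 < y /\ exists al be : 'rV[R]_n,
    v = hcomb p al be /\ sqnorm al + sqnorm be < y ^+ 2.
Proof.
move=> H; have y0 : 0 < y.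
  by rewrite -lte_fin; apply: le_lt_trans H; exact: sqrte_ge0.
split=> //.
have : (sqCCnorm p v < (y ^+ 2)%:E)%E.
  rewrite ltNge; apply: contraL H => H; rewrite -leNgt /CCnorm.
  have yE : y%:E = sqrte (y ^+ 2)%:E by rewrite /= sqrtr_sqr gtr0_norm.
  rewrite yE lee_sqrt//; apply: le_ereal_inf_tmp => _ [ab _ <-].
  by rewrite lee_fin addr_ge0 ?sqnorm_ge0.
move=> /ereal_inf_lt[_ [[al be] /= Hv <-]]; rewrite lte_fin => Hy.
by exists al, be.
Qed.

Lemma CClength_lower_bound (R : realType) (n : nat) (x1 : 'rV[R]_n) (q : 'rV[R]_n * R)
    (bs : R) (g : R -> 'rV[R]_n * R) :
  0 <= bs < pi -> horizontal g -> g 0 = (x1, 0) -> g 1 = q ->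
  ((Num.sqrt (action x1 bs q))%:E <= CClength g)%E.
Proof.
move=> bs_itv [/abs_continuous01_seq ag hg] g0 g1.
have /andP[bs0 bspi] := bs_itv.
have [bm Hbm] := max_action_exists x1 bs_itv.
pose D2 p := action x1 (bm p) p.
(* The multiplier [0] gives the action |x1 - p.1|^2. *)
have D2_ge0 p : 0 <= D2 p.
  have [_ /(_ 0)] := Hbm p; rewrite lexx bs0 => /(_ isT); apply: le_trans.
  have := sqnorm_ge0 (1 *: x1 + (-1) *: p.1); rewrite sqnorm_lin.
  rewrite /action /sinc eqxx cos0 invr1; lra.
have D2_0 : D2 (x1, 0) = 0.
  apply/eqP; rewrite eq_le D2_ge0 andbT.
  have [/andP[b0 bb] _] := Hbm (x1, 0); rewrite /D2 /action /=.
  have S0 : 0 < (sinc (bm (x1, 0)))^-1 by rewrite invr_gt0 sinc_gt0// b0 (le_lt_trans bb).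
  have := cos_le1 (bm (x1, 0)); rewrite -/(sqnorm x1).
  have := sqnorm_ge0 x1.
  move: (cos _) (sqnorm _) (_^-1) S0 => c Q S S0 Q0 c1.
  have : 0 <= S * Q * (1 - c) by rewrite !mulr_ge0 ?subr_ge0// ltW.
  lra.
have D2_q : action x1 bs q <= D2 q.
  by have [_] := Hbm q; apply; rewrite lexx bs0.
apply/lee_addgt0Pr => e e0.
pose K (t : R) := Num.sqrt (e ^+ 2 + D2 (g t)).
have [r r0 Hr] := seq_abs_continuous_bounded ag.
have [L L0 HL] := action_lipschitz x1 bs_itv r0.
have aK : seq_abs_continuous (K : R -> R^o).
  apply: (@lipschitz_seq_abs_continuous _ _ _ g _ (e^-1 * L)) ag => s t s0 st t1.
  apply: le_trans (sqrt_lipschitz e0 (D2_ge0 _) (D2_ge0 _)) _.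
  rewrite -mulrA ler_wpM2l ?invr_ge0 ?(ltW e0)//.
  have gt : `|g t| <= r by apply: Hr; rewrite t1 (le_trans s0).
  have gs : `|g s| <= r by apply: Hr; rewrite s0 (le_trans st).
  have [bt Ht] := Hbm (g t); have [bs' Hs] := Hbm (g s).
  (* The action at the maximiser of one point bounds the maximum at the other point from below. *)
  rewrite ler_norml; apply/andP; split.
    rewrite lerNl opprB distrC; apply: le_trans _ (HL _ _ _ bs' gs gt).
    by rewrite lerD2l lerN2; exact: Ht.
  apply: le_trans _ (HL _ _ _ bt gt gs).
  by rewrite lerD2l lerN2; exact: Hs.
suff : ((K 1 - K 0)%:E <= CClength g)%E.
  move=> H; rewrite -leeBlDr//; apply: le_trans H; rewrite -EFinB lee_fin.
  rewrite /K g0 g1 D2_0 addr0 sqrtr_sqr gtr0_norm// lerD2r ler_wsqrtr//.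
  by rewrite (le_trans D2_q)// lerDr sqr_ge0.
apply: abs_continuous_le_integral => //; first by move=> t; exact: sqrte_ge0.
apply: (@filterS _ _ (ae_filter_ringOfSetsType _) _ _ _ hg) => t Ht t01 y /CCnorm_lt_ex[y0].
have [|dg _] := Ht; first by apply: subset_itv_oo_cc t01.
move=> [al [be [gE ab_y]]].
have Dg : is_derive t 1 g (hcomb (g t) al be).
  by apply: (DeriveDef dg); rewrite -derive1E.
set b0 := bm (g t).
have := is_derive_action_along x1 b0 Dg.
set P := dot al _ + _ => DA.
(* The multiplier is frozen at the maximiser for [g t]: [k0] is differentiable at [t], lies below
   [K] on the left and agrees with it at [t], so left increments of [K] are at most those of
   [k0]. *)
pose k0 (s : R) := Num.sqrt (e ^+ 2 + action x1 b0 (g s)).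
have Kt_gt0 : 0 < K t by rewrite sqrtr_gt0 ltr_wpDr// exprn_gt0.
have Dk : is_derive t 1 k0 (P / K t).
  have D0 : is_derive t 1 (fun s => e ^+ 2 + action x1 b0 (g s)) (2 * P).
    by apply: (is_derive_eq (is_deriveD (is_derive_cst (e ^+ 2) t 1) DA)); rewrite add0r.
  have D1 : is_derive (e ^+ 2 + action x1 b0 (g t)) 1 (@Num.sqrt R) (2 * K t)^-1.
    by apply: is_derive1_sqrt; rewrite -sqrtr_gt0.
  have D3 := @is_derive1_comp R _ (fun s => e ^+ 2 + action x1 b0 (g s)) t _ _ D1 D0.
  apply: (is_derive_eq D3).
  by field; rewrite gt_eqF.
have Pk : P / K t < y.
  rewrite ltr_pdivrMr//; have [P0|P0] := leP P 0.
    by rewrite (le_lt_trans P0)// mulr_gt0.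
  have [b_itv Hb] := Hbm (g t).
  have MD := action_grad_le bspi b_itv Hb.
  rewrite -/b0 in MD.
  have Pab : P ^+ 2 <= (sqnorm al + sqnorm be) * D2 (g t).
    apply: le_trans (dot2_sqr_le _ _ _ _) _.
    rewrite ler_wpM2l ?addr_ge0 ?sqnorm_ge0//; apply: le_trans MD.
    have := sqnorm_lin b0 0 (g t).1 0; rewrite scaler0 addr0 => ->; lra.
  have K2 : K t ^+ 2 = e ^+ 2 + D2 (g t) by rewrite sqr_sqrtr// addr_ge0 ?sqr_ge0.
  have yK : 0 <= y * K t by rewrite mulr_ge0 ?ltW.
  rewrite -(ltr_pXn2r (n := 2))// ?nnegrE ?(ltW P0)//.
  apply: (le_lt_trans Pab); rewrite exprMn K2.
  apply: (@le_lt_trans _ _ (y ^+ 2 * D2 (g t))).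
    by rewrite ler_wpM2r// ltW.
  by rewrite ltr_pM2l ?exprn_gt0// ltrDr exprn_gt0.
have yP : 0 < y - P / K t by rewrite subr_gt0.
apply: filterS (is_derive_left_seq Dk yP) => k Hk.
set s := t - k.+1%:R^-1 in Hk *.
have Ks : k0 s <= K s.
  rewrite /k0 /K ler_wsqrtr// lerD2l; have [_] := Hbm (g s); apply.
  by have [] := Hbm (g t).
have kt : k0 t = K t by [].
move: Hk; rewrite ler_norml => /andP[_]; rewrite kt => Hk.
have : (P / K t) * k.+1%:R^-1 + (y - P / K t) * k.+1%:R^-1 = y * k.+1%:R^-1 by ring.
move: Hk Ks; move: (k.+1%:R^-1) (P / K t) => d l; clear; lra.
Qed.

(** * The geodesics that join the two points *)

(** The origin of [mu]: once [c] is chosen to reach [x], the final height gives the level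
    equation. *)
Lemma gcurve_end (R : realType) (n : nat) (x1 x : 'rV[R]_n) (b : R) :
  sin b != 0 -> sqnorm x1 + sqnorm x != 0 ->
  gcurve x1 b ((b / sin b) *: (x - cos b *: x1)) 1 =
  (x, (sqnorm x1 + sqnorm x) / 2 * mu (2 * dot x1 x / (sqnorm x1 + sqnorm x)) b).
Proof.
move=> s0 N0; have b0 : b != 0 by apply: contraNneq s0 => ->; rewrite sin0.
rewrite /gcurve (negbTE b0) !mulr1; congr pair.
  rewrite scalerA (_ : sin b / b * (b / sin b) = 1); last by field; rewrite s0.
  by rewrite scale1r subrK.
rewrite -mulrA mulr_natl sin_mulr2n dotZr.
have -> : x - cos b *: x1 = 1 *: x + (- cos b) *: x1 by rewrite scale1r scaleNr.
have -> : (b / sin b) *: (1 *: x + (- cos b) *: x1) =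
  (b / sin b) *: x + (- (b / sin b * cos b)) *: x1.
  by rewrite scalerDr !scalerA mulr1 mulrN.
rewrite sqnorm_lin (dotC x1) dot_linl (dotC x x1) -/(sqnorm x1) /mu /cot.
move: (sqnorm x1) (sqnorm x) (dot x1 x) N0 => p q d N0.
have := cos2Dsin2 b; move: (cos b) (sin b) s0 => C s s0 E.
have E1 : C ^+ 2 = 1 - s ^+ 2 by rewrite -E; ring.
by field: E1; rewrite s0 N0.
Qed.

Lemma gcurve_energy (R : realType) (n : nat) (x1 x : 'rV[R]_n) (b : R) :
  sin b != 0 ->
  sqnorm ((b / sin b) *: (x - cos b *: x1)) + b ^+ 2 * sqnorm x1 =
  (b / sin b) ^+ 2 * (sqnorm x1 + sqnorm x - 2 * dot x1 x * cos b).
Proof.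
move=> s0.
have -> : (b / sin b) *: (x - cos b *: x1) =
  (b / sin b) *: x + (- (b / sin b * cos b)) *: x1.
  by rewrite scalerDr scalerN scalerA scaleNr.
rewrite sqnorm_lin (dotC x).
have := cos2Dsin2 b; move: (cos b) (sin b) s0 => C s s0 E.
have E1 : C ^+ 2 = 1 - s ^+ 2 by rewrite -E; ring.
by field: E1; rewrite s0.
Qed.

(** For [b = 0] the curve stays at height [0], and for other [b] with [sin b = 0] it ends over [x1]
    or [- x1]. Otherwise its end determines [c]. *)
Lemma gcurve_joining (R : realType) (n : nat) (x1 x c : 'rV[R]_n) (u b : R) :
  x1 <> x -> x1 <> - x -> 0 < u -> gcurve x1 b c 1 = (x, u) ->
  sin b != 0 /\ c = (b / sin b) *: (x - cos b *: x1).
Proof.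
move=> hx hxN u0; rewrite /gcurve; case: eqP => [_ [_ /esym u_eq0]|/eqP b0].
  by rewrite u_eq0 ltxx in u0.
rewrite !mulr1 => -[Ex _].
have s0 : sin b != 0.
  apply/negP => s0; move: s0 (s0) Ex; rewrite -{1}norm_cos_eq1 => + /eqP ->.
  rewrite mul0r scale0r add0r eqr_norml ler01 andbT => /orP[]/eqP -> Ex.
    by apply: hx; rewrite -Ex scale1r.
  by apply: hxN; rewrite -Ex scaleN1r opprK.
split=> //; rewrite -Ex addrK scalerA (_ : _ * _ = 1) ?scale1r//.
by field; rewrite b0.
Qed.

Theorem theorem2p3 (R : realType) (n : nat) (x1 x : 'rV[R]_n) (u : R)
    (hn : (1 <= n)%N) (hx : x1 <> x) (hxN : x1 <> - x) (hu : 0 < u) :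
  let s := sqnorm x1 + sqnorm x in
  let a := 2 * dot x1 x / s in
  let B := [set b : R | (forall k : int, b <> k%:~R * pi) /\
                        2 * u / s = mu a b] in
  let gam b := gcurve x1 b ((b / sin b) *: (x - cos b *: x1)) in
  let G := geodesics_joining (x1, 0) (x, u) in
  [/\ finite_set G,
      G = [set gam b \_ `[0 : R, 1 : R] | b in B],
      (forall b b', B b -> B b' -> b < b' ->
         (CClength (gam b) < CClength (gam b'))%E)
    & exists b,
      [/\ B `&` `]0 : R, pi[ = [set b],
          (forall g, G g -> g <> gam b \_ `[0 : R, 1 : R] ->
             (CClength (gam b) < CClength g)%E),
          dCC (x1, 0) (x, u) = CClength (gam b),
          CClength (gam b) = (b / sin b * Num.sqrt (s - 2 * dot x1 x * cos b))%:E
        & b / sin b * Num.sqrt (s - 2 * dot x1 x * cos b) =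
          Num.sqrt (2 * b * u + s * (b * cot b) - 2 * (b / sin b) * dot x1 x)]].
Proof.
move=> s a B gam G.
have sq_sum (k : R) : sqnorm (1 *: x1 + k *: x) = sqnorm x1 + 2 * k * dot x1 x + k ^+ 2 * sqnorm x.
  by rewrite sqnorm_lin; ring.
have pos (v : 'rV[R]_n) : v <> 0 -> 0 < sqnorm v.
  by move=> v0; rewrite lt_neqAle sqnorm_ge0 andbT eq_sym; apply/eqP => /sqnorm_eq0.
(* The numbers [s + 2 * dot x1 x] and [s - 2 * dot x1 x] are |x1 + x|^2 and |x1 - x|^2; their
   positivity means [-1 < a < 1]. *)
have h1 : 0 < s + 2 * dot x1 x.
  have := sq_sum 1; rewrite (_ : sqnorm x1 + _ + _ = s + 2 * dot x1 x); last by rewrite /s; ring.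
  move=> <-; apply: pos; rewrite !scale1r => /eqP; rewrite addr_eq0 => /eqP; exact: hxN.
have h2 : 0 < s - 2 * dot x1 x.
  have := sq_sum (-1); rewrite (_ : sqnorm x1 + _ + _ = s - 2 * dot x1 x); last by rewrite /s; ring.
  move=> <-; apply: pos; rewrite scale1r scaleN1r => /eqP; rewrite subr_eq0 => /eqP; exact: hx.
have s_gt0 : 0 < s by lra.
have s_neq0 : s != 0 by rewrite gt_eqF.
have a1 : -1 < a < 1.
  rewrite /a; apply/andP; split; first by rewrite ltr_pdivlMr//; lra.
  by rewrite ltr_pdivrMr//; lra.
have sa : s * a = 2 * dot x1 x by rewrite /a; field.
have m0 : 0 < 2 * u / s by rewrite divr_gt0// mulr_gt0.
have BE b : B b <-> sin b != 0 /\ mu a b = 2 * u / s.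
  by split=> -[/sin_eq0P sb E]; split.
have Bgt0 b : B b -> 0 < b.
  by move=> /BE[sb E]; apply: (mu_gt0 a1 sb); rewrite E.
pose l b := (b / sin b) ^+ 2 * (s - 2 * dot x1 x * cos b).
have lE b : l b = s * ((b / sin b) ^+ 2 * (1 - a * cos b)).
  by rewrite /l -sa; ring.
have Z0 b : 0 < s - 2 * dot x1 x * cos b.
  have := cos_max b; rewrite ler_norml => /andP[c1 c2].
  have [d0|d0] := leP 0 (dot x1 x).
    have : dot x1 x * cos b <= dot x1 x * 1 by rewrite ler_wpM2l.
    lra.
  have : dot x1 x * cos b <= dot x1 x * (-1) by rewrite ler_wnM2l// ltW.
  lra.
have Gl b (g : R -> 'rV[R]_n * R) : sin b != 0 ->
    (forall t : R, t \in `]0 : R, 1 : R[ -> g t = gam b t) ->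
    CClength g = (Num.sqrt (l b))%:E.
  by move=> sb /CClength_gcurve_eq ->; rewrite gcurve_energy.
have GlR b : sin b != 0 -> CClength (gam b \_ `[0 : R, 1 : R]) = (Num.sqrt (l b))%:E.
  move=> sb; apply: Gl => // t t01; rewrite patchE mem_set//.
  exact: (subset_itv_oo_cc t01).
have GlT b : sin b != 0 -> CClength (gam b) = (Num.sqrt (l b))%:E by move=> /Gl; apply.
have l_lt b b' : B b -> B b' -> b < b' -> Num.sqrt (l b) < Num.sqrt (l b').
  move=> Bb Bb' bb'; have b0 := Bgt0 b Bb; have b'0 := Bgt0 b' Bb'.
  move: Bb Bb' => /BE[sb E] /BE[sb' E'].
  rewrite ltr_sqrt; last by rewrite /l mulr_gt0// exprn_even_gt0//= mulf_neq0 ?invr_eq0// gt_eqF.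
  rewrite !lE ltr_pM2l//; apply: mu_speed_lt => //; by rewrite E.
have gam_end b : sin b != 0 -> gam b 1 = (x, s / 2 * mu a b).
  by move=> sb; rewrite /gam gcurve_end.
have GE : G = [set gam b \_ `[0 : R, 1 : R] | b in B].
  apply/seteqP; split=> [_ [g [gg g0 g1] <-]|_ [b /BE[sb E] <-]].
    have [b [c gE]] := (geodesicP x1 g).1 (conj gg g0).
    have Ex : gcurve x1 b c 1 = (x, u) by rewrite -gE// in_itv/= ler01 lexx.
    have [sb cE] := gcurve_joining hx hxN hu Ex.
    exists b; last first.
      apply/funext => t; rewrite !patchE; case: ifPn => // /set_mem t01.
      by rewrite gE// /gam -cE.
    apply/BE; split=> //; have := gam_end b sb; rewrite /gam -cE Ex => -[->].
    by field.
  have [gg g0] : geodesic (gam b) /\ gam b 0 = (x1, 0).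
    by apply/geodesicP; exists b, ((b / sin b) *: (x - cos b *: x1)).
  by exists (gam b) => //; split=> //; rewrite gam_end// E; congr pair; field.
have [b /andP[b0 bpi] Eb] := mu_root_exists a1 m0.
have sb0 : 0 < sin b by rewrite sin_gt0_pi// b0.
have sb : sin b != 0 by rewrite gt_eqF.
have Bb : B b by apply/BE.
have Buniq b' : B b' -> b' < pi -> b' = b.
  move=> Bb' b'pi; have b'0 := Bgt0 b' Bb'; move: Bb' => /BE[_ E'].
  have [lt|lt|//] := ltgtP b' b.
    by have := mu_incr a1 b'0 lt bpi; rewrite E' Eb ltxx.
  by have := mu_incr a1 b0 lt b'pi; rewrite E' Eb ltxx.
have bs0 : 0 < b / sin b by rewrite divr_gt0.
have sqrt_l : Num.sqrt (l b) = b / sin b * Num.sqrt (s - 2 * dot x1 x * cos b).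
  by rewrite /l sqrtrM ?sqr_ge0// sqrtr_sqr gtr0_norm.
(* The left side is [action x1 b (x, u)]; the level equation, solved for [u], equates it with the
   squared length [l b]. *)
have l_action : 2 * b * u + s * (b * cot b) - 2 * (b / sin b) * dot x1 x = l b.
  have -> : u = s / 2 * mu a b by rewrite Eb; field.
  have dE : dot x1 x = s * a / 2 by rewrite sa; field.
  by rewrite /l dE /mu /cot; field.
split.
- rewrite GE; apply: finite_image.
  apply: sub_finite_set (finite_mu_level a1 m0) => b' /BE; exact.
- exact: GE.
- move=> b1 b2 B1 B2 b12; have [s1 _] := (BE b1).1 B1; have [s2 _] := (BE b2).1 B2.
  by rewrite !GlT// lte_fin l_lt.
exists b; split.
- apply/seteqP; split=> [b' [Bb' /= b'pi]|_ ->]; last by split; rewrite //= in_itv/= b0.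
  by apply: Buniq => //; rewrite (itvP b'pi).
- rewrite GE => _ [b' Bb' <-] ne; have [s' _] := (BE b').1 Bb'.
  rewrite GlT// GlR// lte_fin l_lt//; rewrite ltNge; apply/negP => b'b.
  by apply: ne; rewrite (Buniq b')// (le_lt_trans b'b).
(* [gam b] itself is a competitor; conversely [CClength_lower_bound] with the multiplier [b] bounds
   every competitor. *)
- apply/eqP; rewrite eq_le; apply/andP; split.
    apply: ereal_inf_lbound; exists (gam b) => //; split; first exact: horizontal_gcurve.
      exact: gcurve0.
    by rewrite gam_end// Eb; congr pair; field.
  apply: le_ereal_inf_tmp => _ [g [hg g0 g1] <-]; rewrite GlT//.
  have := @CClength_lower_bound _ _ x1 (x, u) b g; rewrite (ltW b0) bpi => /(_ isT hg g0 g1).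
  rewrite /action /sinc (gt_eqF b0) invf_div /= -l_action /cot.
  by rewrite (_ : cos b * _ * _ = s * (b * (cos b / sin b)))//; rewrite /s; ring.
- by rewrite GlT// sqrt_l.
by rewrite l_action sqrt_l.
Qed.
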